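(* Let $K$ be a field, $\underline{T}=(T_1,\ldots,T_r)$, $\underline{Y}=(Y_1,\ldots,Y_s)$, and let $\mathfrak{p}$ be a prime ideal of $K[\underline{T},\underline{Y}]$ with $\mathfrak{p}\cap K[\underline{T}]=\{0\}$ and $\dim_{K(\underline{T})}\big(K(\underline{T})[\underline{Y}]/\tilde{\mathfrak{p}}\big)=d>0$, where $\tilde{\mathfrak{p}}$ is the extension of $\mathfrak{p}$ to $K(\underline{T})[\underline{Y}]$. Let $0<\rho\le r$, fix non-negative integers $D_1,\ldots,D_\rho$, and for $i=1,\ldots,\rho$ set $\mathcal{Q}_{S_i,R_i}(\underline{\Lambda}_i,\underline{T},\underline{Y})=\mathcal{U}_{D_i}(\underline{\Lambda}_i,\underline{Y})-T_i$, where $\mathcal{U}_{D_i}(\underline{\Lambda}_i,\underline{Y})$ is the generic polynomial of degree $D_i$ in $\underline{Y}$ with coefficient variables $\underline{\Lambda}_i$ (pairwise disjoint sets); put $\underline{\underline{\Lambda}}=(\underline{\Lambda}_1,\ldots,\underline{\Lambda}_\rho)$. Then the ideal $\mathfrak{P}_{\underline{S}}=\langle\mathfrak{p},\mathcal{Q}_{S_1,R_1},\ldots,\mathcal{Q}_{S_\rho,R_\rho}\rangle$ of $K[\underline{\underline{\Lambda}},\underline{T},\underline{Y}]$ is prime, $\mathfrak{P}_{\underline{S}}\cap K[\underline{\underline{\Lambda}}]=\{0\}$, and $\dim_{K(\underline{\underline{\Lambda}})}\big(K(\underline{\underline{\Lambda}})[\underline{T},\underline{Y}]/\tilde{\mathfrak{P}}_{\underline{S}}\big)=d+r-\rho$,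 where $\tilde{\mathfrak{P}}_{\underline{S}}$ is the extension of $\mathfrak{P}_{\underline{S}}$ to $K(\underline{\underline{\Lambda}})[\underline{T},\underline{Y}]$.
   Context: The generic polynomial of degree $D$ in $\underline{Y}$ is $\mathcal{U}_D(\underline{\Lambda},\underline{Y})=\sum_{j=1}^{N_D}\Lambda_jQ_j(\underline{Y})$, where $Q_1,\ldots,Q_{N_D}$ are all the power products $Y_1^{\beta_1}\cdots Y_s^{\beta_s}$ of total degree $\le D$ and $\underline{\Lambda}=(\Lambda_1,\ldots,\Lambda_{N_D})$ are new variables. Dimensions are Krull dimensions. *)

(* Defs.v *)
From HB Require Import structures.
From mathcomp Require Import all_boot all_algebra.
From mathcomp Require Import generic_quotient ring_quotient.
From mathcomp Require Export mpoly.

Set Implicit Arguments.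
Unset Strict Implicit.
Unset Printing Implicit Defensive.

Import GRing.Theory.
Local Open Scope ring_scope.

(* The library ideals [idealr] and [prime_idealr] are boolean predicates and
   are proper by definition. Ideals obtained by generation are not given with
   a boolean membership test (nor known to be proper in advance), so subsets
   of a ring are Prop-valued, and compared with the library structures up to
   extensional equality. *)

Definition is_prime_ideal (A : comNzRingType) (I : A -> Prop) : Prop :=
  exists J : prime_idealr A, forall x, I x <-> x \in J.

Definition ideal_gen (A : comNzRingType) (S : A -> Prop) (x : A) : Prop :=
  exists n (a g : 'I_n -> A),
    (forall i, S (g i)) /\ x = \sum_(i < n) a i * g i.

Definition ideal_ext (A B : comNzRingType) (f : A -> B) (I : A -> Prop) :
    B -> Prop :=
  ideal_gen (fun y => exists2 x, I x & y = f x).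

Definition has_prime_chain (A : comNzRingType) (n : nat) : Prop :=
  exists q : 'I_n.+1 -> prime_idealr A,
    forall i j : 'I_n.+1, (i < j)%N ->
      {subset q i <= q j} /\ ~ {subset q j <= q i}.

Definition krull_dim (A : comNzRingType) (d : nat) : Prop :=
  has_prime_chain A d /\ forall n, has_prime_chain A n -> (n <= d)%N.

(* The Krull dimension of A / I is d. If I is the unit ideal there is no such
   J, in agreement with the zero ring having no dimension in nat. *)
Definition krull_dim_quot (A : comNzRingType) (I : A -> Prop) (d : nat) :
    Prop :=
  exists J : idealr A, (forall x, I x <-> x \in J) /\
    krull_dim {ideal_quot J} d.

(* {mpoly K[m + n]} is the polynomial ring in a first block of m variables
   'X_(lshift n i) and a second block of n variables 'X_(rshift m j). *)
Section Blocks.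

Variables (K : fieldType) (m n : nat).

Definition emb_left (f : {mpoly K[m]}) : {mpoly K[m + n]} :=
  f \mPo [tuple 'X_(lshift n i) | i < m].

Definition emb_right (f : {mpoly K[n]}) : {mpoly K[m + n]} :=
  f \mPo [tuple 'X_(rshift m j) | j < n].

(* K(X) for the first block X; K(X)[Z] is then {mpoly (ratfrac K m)[n]}. *)
Definition ratfrac : fieldType := {fraction {mpoly K[m]}}.

(* The inclusion K[X, Z] -> K(X)[Z]. *)
Definition to_generic (f : {mpoly K[m + n]}) : {mpoly ratfrac[n]} :=
  mmap (@mpolyC n ratfrac \o @tofrac {mpoly K[m]} \o @mpolyC m K)
       (fun k => match split k with
                 | inl i => (tofrac ('X_i : {mpoly K[m]}) : ratfrac)%:MP
                 | inr j => 'X_j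
                 end) f.

End Blocks.

Section GenericSystem.

Variables (K : fieldType) (r s rho : nat) (D : 'I_rho -> nat).

(* Index set of the coefficient variables: pairs of an i < rho and a power
   product in Y_1, ..., Y_s of total degree at most D i. *)
Definition Lidx : finType := {i : 'I_rho & 'X_{1..s < (D i).+1}}.

(* K[Lambda, T, Y], with blocks of variables in this order. *)
Local Notation KLTY := {mpoly K[#|Lidx| + (r + s)]}.

Definition Lvar (i : 'I_rho) (b : 'X_{1..s < (D i).+1}) : KLTY :=
  'X_(lshift (r + s) (enum_rank (Tagged _ b : Lidx))).

Definition Tvar (i : 'I_r) : KLTY := 'X_(rshift #|Lidx| (lshift s i)).

Definition Yvar (j : 'I_s) : KLTY := 'X_(rshift #|Lidx| (rshift r j)).

Definition generic_poly (i : 'I_rho) : KLTY :=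
  \sum_(b : 'X_{1..s < (D i).+1}) Lvar b * \prod_(j < s) Yvar j ^+ b j.

Definition Qpoly (hrho : (rho <= r)%N) (i : 'I_rho) : KLTY :=
  generic_poly i - Tvar (widen_ord hrho i).

Definition PS (p : {mpoly K[r + s]} -> Prop) (hrho : (rho <= r)%N) :
    KLTY -> Prop :=
  ideal_gen (fun g => (exists2 f, p f & g = emb_right #|Lidx| f) \/
                      (exists i, g = Qpoly hrho i)).

End GenericSystem.

Arguments to_generic {K} m n f.
Arguments Lidx s {rho} D.
Arguments PS {K r s rho} D p hrho _.

(* Main.v *)
(** Write A = K[T,Y]/p, a domain of transcendence degree d + r over K. The i-th
    equation expresses the constant coefficient of the i-th generic polynomial
    through T_i, Y and the other coefficients, so the quotient by P_S is the
    polynomial ring A[Lambda'] in the non-constant coefficients Lambda'; hence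
    P_S is prime. Setting Lambda' = 0 sends the constant coefficients to
    T_1, ..., T_rho, which are algebraically independent; therefore Lambda is
    independent too and P_S meets K[Lambda] in 0. Finally the dimension over
    K(Lambda) is a transcendence degree:
    (d + r + |Lambda'|) - (|Lambda'| + rho) = d + r - rho.

    Dimension equals transcendence degree for a finitely generated domain: if
    P < Q are primes and a is in Q but not in P, then a family independent
    modulo Q together with a is independent modulo P; conversely, given a family
    t :: s independent modulo P, there is a prime Q > P modulo which s is still
    independent. *)

Require Import Defs.
From HB Require Import structures.
From mathcomp Require Import all_boot all_algebra generic_quotient ring_quotient.
From mathcomp Require Import boolp wochoice.
From mathcomp Require Import ring zify.
Set Implicit Arguments.
Unset Strict Implicit.
Unset Printing Implicit Defensive.

Import GRing.Theory.

(** * Prime ideals as kernels *)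

Section PrimeIdeals.
Local Open Scope ring_scope.
Local Open Scope quotient_scope.

Section Kernel.
Variables (A : comNzRingType) (E : idomainType) (f : {rmorphism A -> E}).
Definition kernel : pred A := fun x => f x == 0.

Lemma kernel_idealr_closed : idealr_closed kernel.
Proof.
split.
- by rewrite /kernel unfold_in rmorph0.
- by rewrite /kernel unfold_in rmorph1 oner_eq0.
move=> a u v; rewrite /kernel !unfold_in rmorphD rmorphM => /eqP-> /eqP->.
by rewrite mulr0 addr0.
Qed.

Lemma kernel_prime_closed : prime_idealr_closed kernel.
Proof. by move=> u v; rewrite /kernel !unfold_in rmorphM mulf_eq0. Qed.

HB.instance Definition _ := isIdealr.Build A kernel kernel_idealr_closed.
HB.instance Definition _ := isPrimeIdealrClosed.Build A kernel kernel_prime_closed.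
End Kernel.

Definition domain_quot (A : comNzRingType) (J : prime_idealr A) : Type := {ideal_quot J}.

Section DomainQuot.
Variables (A : comNzRingType) (J : prime_idealr A).
Local Notation Q := (domain_quot J).
HB.instance Definition _ := GRing.ComNzRing.on Q.
Definition dq_unit : pred Q := fun x => `[< exists y, y * x = 1 >].
Definition dq_inv (x : Q) : Q :=
  if pselect (exists y, y * x = 1) is left h then projT1 (cid h) else x.
Lemma dq_mulVr : {in dq_unit, left_inverse 1 dq_inv *%R}.
Proof.
move=> x /asboolP hx; rewrite /dq_inv; case: pselect => // h.
by case: (cid h).
Qed.

Lemma dq_unitP (x y : Q) : y * x = 1 -> dq_unit x.
Proof. by move=> h; apply/asboolP; exists y. Qed.

Lemma dq_inv_out : {in [predC dq_unit], dq_inv =1 id}.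
Proof.
move=> x; rewrite inE => /asboolP hx; rewrite /dq_inv; case: pselect => //.
Qed.

HB.instance Definition _ := GRing.ComNzRing_hasMulInverse.Build Q dq_mulVr dq_unitP dq_inv_out.
Lemma dq_idomain : GRing.integral_domain_axiom Q.
Proof. exact: Quotient.rquot_IdomainAxiom. Qed.

HB.instance Definition _ := GRing.ComUnitRing_isIntegral.Build Q dq_idomain.
End DomainQuot.

(** The quotient embeds in its fraction field. Primes are handled below through such a morphism to a
    field. *)
Lemma prime_idealr_kernel (A : comNzRingType) (J : prime_idealr A) :
  exists (L : fieldType) (f : {rmorphism A -> L}), forall x, (f x == 0) = (x \in J).
Proof.
exists {fraction domain_quot J}.
exists (@tofrac (domain_quot J) \o (\pi_{ideal_quot J} : A -> domain_quot J)) => x /=.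
rewrite tofrac_eq0 -(rmorph0 (\pi_{ideal_quot J})) -Quotient.idealrBE subr0.
by [].
Qed.

End PrimeIdeals.

(** * Algebraic independence modulo an ideal *)

Section AlgebraicIndependence.
Local Open Scope ring_scope.

Lemma mpoly_rmorph_eq n (R S : comNzRingType) (f g : {rmorphism {mpoly R[n]} -> S}) :
  (forall c, f c%:MP = g c%:MP) -> (forall i, f 'X_i = g 'X_i) -> f =1 g.
Proof.
move=> fgC fgX p; rewrite (mpolyE p) !rmorph_sum /=; apply: eq_bigr => m _.
rewrite -mul_mpolyC !rmorphM /= fgC mpolyXE_id !rmorph_prod /=; congr (_ * _).
by apply: eq_bigr => i _; rewrite !rmorphXn /= fgX.
Qed.

Lemma poly_rmorph_eq (R S : comNzRingType) (f g : {rmorphism {poly R} -> S}) :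
  (forall c, f c%:P = g c%:P) -> f 'X = g 'X -> f =1 g.
Proof.
move=> fgC fgX; elim/poly_ind => [|p c IH]; first by rewrite !rmorph0.
by rewrite !rmorphD !rmorphM /= IH fgC fgX.
Qed.

Section SplitVar.
Variables (n : nat) (k : comNzRingType).

Definition mshift : {mpoly k[n]} -> {mpoly k[n.+1]} :=
  mmap (@mpolyC n.+1 k) (fun j => 'X_(lift ord0 j)).

(** Isolating the first variable turns a relation on a list with head [x] into a univariate
    polynomial that vanishes at [x]; see [alg_indep_cons]. *)
Definition msplit : {mpoly k[n.+1]} -> {poly {mpoly k[n]}} :=
  mmap (polyC \o @mpolyC n k)
    (fun i => if unlift ord0 i is Some j then ('X_j)%:P else 'X).

HB.instance Definition _ := GRing.RMorphism.on mshift.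
HB.instance Definition _ := GRing.RMorphism.on msplit.

Definition mjoin : {poly {mpoly k[n]}} -> {mpoly k[n.+1]} :=
  horner_eval 'X_ord0 \o map_poly mshift.

HB.instance Definition _ := GRing.RMorphism.on mjoin.

Lemma mshiftC c : mshift c%:MP = c%:MP.
Proof. exact: mmapC. Qed.

Lemma mshiftX i : mshift 'X_i = 'X_(lift ord0 i).
Proof. by rewrite /mshift mmapX mmap1U. Qed.

Lemma msplitC c : msplit c%:MP = c%:MP%:P.
Proof. exact: mmapC. Qed.

Lemma msplitX0 : msplit 'X_ord0 = 'X.
Proof. by rewrite /msplit mmapX mmap1U unlift_none. Qed.

Lemma msplitX i : msplit 'X_(lift ord0 i) = ('X_i)%:P.
Proof. by rewrite /msplit mmapX mmap1U liftK. Qed.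

Lemma mjoinC c : mjoin c%:P = mshift c.
Proof. by rewrite /mjoin /= map_polyC /horner_eval hornerC. Qed.

Lemma mjoinX : mjoin 'X = 'X_ord0.
Proof. by rewrite /mjoin /= map_polyX /horner_eval hornerX. Qed.

Lemma msplitK : cancel msplit mjoin.
Proof.
apply: (mpoly_rmorph_eq (f := mjoin \o msplit) (g := idfun)) => [c|i] /=.
  by rewrite msplitC mjoinC mshiftC.
case: (unliftP ord0 i) => [j|] ->; first by rewrite msplitX mjoinC mshiftX.
by rewrite msplitX0 mjoinX.
Qed.

Lemma mjoinK : cancel mjoin msplit.
Proof.
apply: (poly_rmorph_eq (f := msplit \o mjoin) (g := idfun)) => [c|] /=.
  rewrite mjoinC; apply: (mpoly_rmorph_eq (f := msplit \o mshift) (g := polyC)).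
    by move=> a /=; rewrite mshiftC msplitC.
  by move=> i /=; rewrite mshiftX msplitX.
by rewrite mjoinX msplitX0.
Qed.

End SplitVar.

Section Def.
Variables (k : fieldType) (E : comNzRingType) (h : {rmorphism k -> E}).
Implicit Types (P : E -> Prop) (s t : seq E).

Definition peval s : {mpoly k[size s]} -> E := mmap h (fun i => s`_i).

Arguments peval : clear implicits.

HB.instance Definition _ s :=
  GRing.RMorphism.copy (peval s) (mmap h (fun i : 'I_(size s) => s`_i)).

(* P is meant to be an ideal; equality to 0 gives independence in E itself. *)
Definition alg_indep P s := forall g, P (peval s g) -> g = 0.

Lemma pevalC s c : peval s c%:MP = h c.
Proof. exact: mmapC. Qed.

Lemma pevalX s i : peval s 'X_i = s`_i.
Proof. by rewrite /peval mmapX mmap1U. Qed.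

Lemma alg_indepW P P' s : (forall x, P' x -> P x) ->
  alg_indep P s -> alg_indep P' s.
Proof. by move=> PP' ind g /PP'/ind. Qed.

(** Renaming the variables along the injection [sg] has a left inverse, which sends the variables
    outside the image to 0. So a nonzero relation among the selected entries stays nonzero as a
    relation on [t]. *)
Lemma alg_indep_map P t (js : seq nat) : uniq js -> {in js, forall j, (j < size t)%N} ->
  alg_indep P t -> alg_indep P [seq t`_j | j <- js].
Proof.
set s := map _ _ => js_uniq js_lt ind g Pg.
have szs : size s = size js by rewrite size_map.
have hjs (i : 'I_(size s)) : (nth 0 js i < size t)%N.
  by apply/js_lt/mem_nth; rewrite -szs.
pose sg (i : 'I_(size s)) := Ordinal (hjs i).
have sg_inj : injective sg.
  move=> i j [] /eqP; rewrite nth_uniq ?ltn_ord -?szs // => /eqP; exact: val_inj.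
pose r : {rmorphism {mpoly k[size s]} -> {mpoly k[size t]}} :=
  mmap (@mpolyC (size t) k) (fun i => 'X_(sg i)).
pose l : {rmorphism {mpoly k[size t]} -> {mpoly k[size s]}} := mmap (@mpolyC (size s) k)
  (fun j => if [pick i | sg i == j] is Some i then 'X_i else 0).
have evr : peval t \o r =1 peval s.
  apply: mpoly_rmorph_eq => [c|i] /=; rewrite /r ?mmapC ?pevalC //.
  by rewrite mmapX mmap1U !pevalX (nth_map 0%N) // -szs.
have lr : l \o r =1 idfun.
  apply: mpoly_rmorph_eq => [c|i] /=; rewrite /r /l ?mmapC //.
  rewrite !(mmapX, mmap1U); case: pickP => [j /eqP/sg_inj-> //|/(_ i)].
  by rewrite eqxx.
have <- : l (r g) = g by apply: lr.
rewrite (ind (r g)) ?rmorph0 //.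
by have /= -> := evr g.
Qed.

Lemma alg_indep_perm P s t : perm_eq s t -> alg_indep P t -> alg_indep P s.
Proof.
case/(perm_iotaP 0) => js js_iota -> ind; apply: alg_indep_map => //.
  by rewrite (perm_uniq js_iota) iota_uniq.
by move=> j; rewrite (perm_mem js_iota) mem_iota.
Qed.

Lemma alg_indep_subseq P s t : subseq s t -> alg_indep P t -> alg_indep P s.
Proof.
case/subseqP => m sm -> ind.
rewrite -[in mask m t](mkseq_nth 0 t) /mkseq -map_mask.
apply: alg_indep_map => //.
  by rewrite mask_uniq // iota_uniq.
by move=> j /mem_mask; rewrite mem_iota.
Qed.

(** With no variables [g] is a constant, and a nonzero constant in [P] would put 1 in [P]. *)
Lemma alg_indep_nil P : ~ P 1 -> (forall a x, P x -> P (a * x)) -> alg_indep P [::].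
Proof.
move=> P1 PM g Pg; have [c def_g] : exists c, g = c%:MP.
  exists g@_0%MM; apply/mpolyP => m; rewrite mcoeffC.
  have -> : m = 0%MM by apply/mnmP => -[].
  by rewrite eqxx mulr1.
rewrite {}def_g pevalC in Pg *.
have [->|c0] := eqVneq c 0; first exact: mpolyC0.
case: P1; have := PM (h c^-1) _ Pg.
by rewrite -rmorphM mulVf // rmorph1.
Qed.

Lemma peval_mjoin x s q :
  peval (x :: s) (mjoin q) = (map_poly (peval s) q).[x].
Proof.
apply: (poly_rmorph_eq (f := peval (x :: s) \o @mjoin (size s) k)
  (g := horner_eval x \o map_poly (peval s))) => [c|] /=; last first.
  by rewrite mjoinX pevalX map_polyX /horner_eval hornerX.
rewrite mjoinC map_polyC /= /horner_eval hornerC.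
apply: (mpoly_rmorph_eq (f := peval (x :: s) \o @mshift (size s) k)) => [a|i] /=.
  by rewrite mshiftC !pevalC.
by rewrite mshiftX !pevalX.
Qed.

Lemma alg_indep_cons P x s : alg_indep P (x :: s) <->
  forall q : {poly {mpoly k[size s]}}, P ((map_poly (peval s) q).[x]) -> q = 0.
Proof.
split=> [ind q Pq|ind g Pg].
  by rewrite -(mjoinK q) (ind (mjoin q)) ?rmorph0 // peval_mjoin.
by rewrite -(msplitK g) (ind (msplit g)) ?rmorph0 // -peval_mjoin msplitK.
Qed.

(* In a relation with coefficients in k[s], the constant term lies in ker g,
   hence vanishes; then divide by a, which is not in the prime ker f. *)
Lemma alg_indep_kernel_cons (F G : idomainType) (f : {rmorphism E -> F})
    (g : {rmorphism E -> G}) a s :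
    (forall x, f x = 0 -> g x = 0) -> g a = 0 -> f a != 0 ->
  alg_indep (fun x => g x = 0) s -> alg_indep (fun x => f x = 0) (a :: s).
Proof.
move=> fg ga fa ind; apply/alg_indep_cons; elim/poly_ind => [//|q c IH].
rewrite rmorphD rmorphM /= map_polyX map_polyC /= hornerMXaddC => fqa.
have c0 : c = 0.
  by apply: ind; move/fg: fqa; rewrite rmorphD rmorphM ga mulr0 add0r.
move/eqP: fqa; rewrite c0 rmorph0 !addr0 rmorphM mulf_eq0 (negbTE fa) orbF.
by move/eqP/IH->; rewrite mul0r.
Qed.

(** Stepping down from [q] to a strictly smaller prime gains one independent element. *)
Lemma alg_indep_prime_cons (p q : prime_idealr E) a s :
    {subset p <= q} -> a \in q -> a \notin p ->
  alg_indep (fun x => x \in q) s -> alg_indep (fun x => x \in p) (a :: s).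
Proof.
move=> pq qa pa ind; have [F [f fP]] := prime_idealr_kernel p.
have [G [g gP]] := prime_idealr_kernel q.
apply: (@alg_indepW (fun x => f x = 0)) => [x|]; first by rewrite -fP => /eqP.
apply: (alg_indep_kernel_cons (g := g)); rewrite ?fP //.
- by move=> x /eqP; rewrite fP => /pq; rewrite -gP => /eqP.
- by apply/eqP; rewrite gP.
- by apply: alg_indepW ind => x; rewrite -gP => ->.
Qed.

End Def.
End AlgebraicIndependence.
Arguments peval {k E} h s g.

(** * Prime chains *)

Section Chains.
Local Open Scope ring_scope.
Local Open Scope quotient_scope.

Lemma mpoly_ring_ind n (R : comNzRingType) (P : {mpoly R[n]} -> Prop) :
  (forall c, P c%:MP) -> (forall i, P 'X_i) ->
  (forall p q, P p -> P q -> P (p + q)) ->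
  (forall p q, P p -> P q -> P (p * q)) -> forall p, P p.
Proof.
move=> PC PX PD PM; elim/mpolyind => [|c m p _ _ IH]; first by rewrite -mpolyC0.
apply: PD => //; rewrite -mul_mpolyC; apply: (PM) => //.
have P1 : P 1 by rewrite -mpolyC1.
rewrite mpolyXE_id; elim/big_rec: _ => // i q _ Pq; apply: (PM) => //.
by elim: (m i) => // e IHe; rewrite exprS; apply: (PM).
Qed.

(** The polynomial ring in [alg_indep] depends on the list through [size s]; this form transports it
    to any [n] equal to that size. *)
Lemma alg_indepP (k : fieldType) (E : comNzRingType) (h : {rmorphism k -> E})
    (P : E -> Prop) n (v : 'I_n -> E) s :
  size s = n -> (forall i : 'I_n, v i = s`_i) ->
  alg_indep h P s <-> (forall g, P (mmap h v g) -> g = 0).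
Proof.
move=> szs; case: _ / szs in v * => vs.
by have -> : v = (fun i => s`_i) by apply: funext.
Qed.

Lemma alg_indep_enumP (k : fieldType) (E : comNzRingType) (h : {rmorphism k -> E})
    (P : E -> Prop) n (v : 'I_n -> E) :
  alg_indep h P [seq v i | i <- enum 'I_n] <->
  (forall g, P (mmap h v g) -> g = 0).
Proof.
apply: alg_indepP => [|i]; first by rewrite size_map size_enum_ord.
by rewrite (nth_map i) ?size_enum_ord // nth_ord_enum.
Qed.

Lemma mmap_peval (k : fieldType) (E : comNzRingType) (h : {rmorphism k -> E})
    n (v : 'I_n -> E) s (g : {mpoly k[n]}) :
  size s = n -> (forall i : 'I_n, v i = s`_i) ->
  exists g', mmap h v g = peval h s g'.
Proof.
move=> szs; case: _ / szs in v g * => vs.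
by exists g; congr (mmap _ _ g); apply: funext.
Qed.

Section Rmorph.
Variables (k : fieldType) (A B : comNzRingType).
Variables (h : {rmorphism k -> A}) (f : {rmorphism A -> B}).

Let mmap_rmorph s g :
  mmap (f \o h) (fun i : 'I_(size s) => f s`_i) g = f (peval h s g).
Proof.
apply: (mpoly_rmorph_eq (g := f \o peval h s)) => [c|i] /=.
  by rewrite mmapC pevalC.
by rewrite mmapX mmap1U pevalX.
Qed.

Lemma alg_indep_rmorph (P : B -> Prop) s :
  alg_indep (f \o h) P (map f s) <-> alg_indep h (fun x => P (f x)) s.
Proof.
rewrite (@alg_indepP _ _ (f \o h) P _ (fun i : 'I_(size s) => f s`_i)); first last.
- by move=> i; rewrite (nth_map 0).
- by rewrite size_map.
by split=> ind g; have := ind g; rewrite mmap_rmorph.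
Qed.

Lemma peval_map s (g : {mpoly k[size s]}) :
  exists g', f (peval h s g) = peval (f \o h) (map f s) g'.
Proof.
rewrite -mmap_rmorph.
by apply: mmap_peval => [|i]; rewrite ?size_map // (nth_map 0).
Qed.

End Rmorph.

(** Start with the empty list at the largest prime of the chain and descend; each strict inclusion
    adds one element by [alg_indep_prime_cons]. *)
Lemma prime_chain_indep (k : fieldType) (A : comNzRingType)
    (h : {rmorphism k -> A}) n : has_prime_chain A n ->
  exists2 s : seq A, size s = n & alg_indep h (fun x => x = 0) s.
Proof.
case=> q qP.
suff /(_ n (leqnn n)) [s szs inds] : forall i, (i <= n)%N ->
    exists2 s : seq A, size s = i & alg_indep h (fun x => x \in q (inord (n - i))) s.
  by exists s => //; apply: alg_indepW inds => x ->; exact: idealr0.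
elim=> [_|i IH lt_in].
  exists [::] => //; apply: alg_indep_nil; first by rewrite idealr1.
  by move=> a x; apply: idealMr.
have [s szs inds] := IH (ltnW lt_in).
have := qP (inord (n - i.+1)) (inord (n - i)).
rewrite !inordK ?ltnS ?leq_subr // ltn_sub2lE // leqnn => -[] // sub.
move/existsNP => [a /not_implyP[qa /negP q'a]].
exists (a :: s); first by rewrite /= szs.
exact: alg_indep_prime_cons sub qa q'a inds.
Qed.

(** Zorn's lemma gives an ideal maximal among those that contain [I] and are disjoint from the
    multiplicative set [S]; maximality forces it to be prime. *)
Lemma avoiding_prime (A : comNzRingType) (S I : A -> Prop) :
    S 1 -> (forall x y, S x -> S y -> S (x * y)) ->
    I 0 -> (forall x y, I x -> I y -> I (x + y)) ->
    (forall a x, I x -> I (a * x)) -> (forall x, I x -> ~ S x) ->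
  exists2 q : prime_idealr A, (forall x, I x -> x \in q) &
    (forall x, x \in q -> ~ S x).
Proof.
move=> S1 SM I0 ID IM IS.
pose ideal (X : pred A) := [/\ forall x, I x -> X x,
  forall x y, X x -> X y -> X (x + y), forall a x, X x -> X (a * x) &
  forall x, X x -> ~ S x].
pose R (X Y : pred A) : bool := `[< forall x, X x -> Y x >].
pose T : pred (pred A) := fun X => `[< ideal X >].
have [|||m /asboolP[mI mD mM mS] m_max] := @Zorn's_lemma _ R T.
- by move=> X _; apply/asboolP.
- by move=> X Y Z _ _ _ /asboolP XY /asboolP YZ; apply/asboolP => x /XY/YZ.
- move=> C CT C_wo; have C_tot := wo_chainW C_wo.
  (* The empty chain is bounded by [I] itself, any other chain by its union. *)
  have [[X0 CX0]|C0] := pselect (exists X, X \in C); last first.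
    exists (fun x => `[< I x >]); last by move=> X CX; case: C0; exists X.
    apply/asboolP; split=> [x Ix|x y /asboolP Ix /asboolP Iy|a x /asboolP Ix|x].
    + exact/asboolP.
    + by apply/asboolP/ID.
    + by apply/asboolP/IM.
    + by move=> /asboolP; apply: IS.
  pose U : pred A := fun x => `[< exists2 X, X \in C & X x >].
  exists U; last by move=> X CX; apply/asboolP => x Xx; apply/asboolP; exists X.
  have Cid X : X \in C -> ideal X by move/CT/asboolP.
  apply/asboolP; split=> [x Ix|x y|a x|x].
  + by apply/asboolP; exists X0 => //; have [+ _ _ _] := Cid _ CX0; apply.
  + move=> /asboolP[X CX Xx] /asboolP[Y CY Yy]; apply/asboolP.
    have /orP[/asboolP XY|/asboolP YX] := C_tot X Y CX CY.
      by exists Y => //; have [_ YD _ _] := Cid _ CY; apply: YD => //; apply: XY.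
    by exists X => //; have [_ XD _ _] := Cid _ CX; apply: XD => //; apply: YX.
  + move=> /asboolP[X CX Xx]; apply/asboolP.
    by exists X => //; have [_ _ XM _] := Cid _ CX; apply: XM.
  + by move=> /asboolP[X CX Xx]; have [_ _ _ +] := Cid _ CX; apply.
have mN x : m x -> m (- x) by rewrite -mulN1r; apply: mM.
(* By maximality, adjoining to [m] an element outside it produces an ideal that meets [S]. *)
have m_add u : ~~ m u -> exists x r, m x /\ S (x + r * u).
  move=> mu; apply: contrapT => noS.
  pose X : pred A := fun y => `[< exists x r, m x /\ y = x + r * u >].
  have mX x : m x -> X x.
    by move=> mx; apply/asboolP; exists x, 0; rewrite mul0r addr0.
  have TX : X \in T.
    apply/asboolP; split=> [x /mI/mX //|x y|a x|x].
    - move=> /asboolP[x1 [r1 [mx1 ->]]] /asboolP[x2 [r2 [mx2 ->]]]; apply/asboolP.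
      by exists (x1 + x2), (r1 + r2); split; [exact: mD|rewrite mulrDl addrACA].
    - move=> /asboolP[x1 [r1 [mx1 ->]]]; apply/asboolP.
      by exists (a * x1), (a * r1); split; [exact: mM|rewrite mulrDr mulrA].
    - by move=> /asboolP[x1 [r1 [mx1 ->]]] Sx; apply: noS; exists x1, r1.
  have /m_max/(_ _)/asboolP := TX; move=> /(_ _ u) Xm.
  case/negP: mu; apply: Xm; first exact/asboolP.
  by apply/asboolP; exists 0, 1; rewrite mul1r add0r; split=> //; apply: mI.
have m_ideal : idealr_closed m.
  split; first exact: mI.
    by apply/negP => m1; case: (mS 1).
  by move=> a u v mu mv; apply: mD => //; apply: mM.
have m_prime : prime_idealr_closed m.
  move=> u v muv; apply: contrapT => /negP; rewrite negb_or => /andP[mu mv].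
  (* The product of these two elements of [S] lies in [m] as soon as [u * v] does, which contradicts
     disjointness. *)
  have [x [r [mx Sx]]] := m_add u mu; have [y [r' [my Sy]]] := m_add v mv.
  apply: (mS _ _ (SM _ _ Sx Sy)).
  rewrite mulrDl mulrC; apply: (mD); first exact: mM.
  rewrite mulrDr; apply: (mD); first exact: mM.
  by rewrite mulrACA; apply: mM.
pose q1 := isIdealr.Build A m m_ideal.
pose q2 := isPrimeIdealrClosed.Build A m m_prime.
by exists (HB.pack m q1 q2 : prime_idealr A).
Qed.

End Chains.

(** * Denominators and divisibility for integral elements *)

Section Integrality.
Local Open Scope ring_scope.
Local Open Scope quotient_scope.

(** For [p] of degree [n + 1] with leading coefficient [c], multiplying [p(x) = 0] by [c ^ n] gives
    a monic equation for [c x], whose lower coefficients are those of [r]. *)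
Lemma integral_lead_coef (R : comNzRingType) (L : idomainType) (f : {rmorphism R -> L})
    (p : {poly R}) x : f (lead_coef p) != 0 -> root (map_poly f p) x ->
  integralOver f (f (lead_coef p) * x).
Proof.
set c := lead_coef p => c0 /rootP px.
case def_n: (size p) => [|[|n]].
- by move/eqP: def_n c0; rewrite size_poly_eq0 /c => /eqP->; rewrite lead_coef0 rmorph0 eqxx.
- have /size1_polyC def_p : (size p <= 1)%N by rewrite def_n.
  by move: px c0; rewrite /c def_p map_polyC hornerC lead_coefC /= => ->; rewrite eqxx.
pose r := \poly_(i < n.+1) (p`_i * c ^+ (n - i)).
have sz_r : (size r <= n.+1)%N by apply: size_poly.
exists ('X^(n.+1) + r).
  by rewrite monicE lead_coefDl ?lead_coefXn // size_polyXn ltnS.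
rewrite rootE rmorphD /= map_polyXn hornerD hornerXn.
have -> : map_poly f r = \poly_(i < n.+1) f (p`_i * c ^+ (n - i)).
  apply/polyP => i; rewrite coef_map /r !coef_poly; case: ifP => // _; exact: rmorph0.
rewrite horner_poly exprMn.
have def_c : c = p`_n.+1 by rewrite /c lead_coefE def_n.
have {px} : f c * x ^+ n.+1 + \sum_(i < n.+1) f p`_i * x ^+ i = 0.
  rewrite -[RHS]px horner_coef size_map_poly_id0 // def_n [RHS]big_ord_recr /= addrC.
  by rewrite def_c coef_map; congr (_ + _); apply: eq_bigr => i _; rewrite coef_map.
move/(congr1 (fun y => f c ^+ n * y)); rewrite mulr0 mulrDr mulrA -exprSr => E.
rewrite -[X in _ == X]E; apply/eqP; congr (_ + _).
rewrite mulr_sumr; apply: eq_bigr => i _.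
rewrite rmorphM rmorphXn exprMn.
have -> : f c ^+ n = f c ^+ (n - i) * f c ^+ i by rewrite -exprD subnK // -ltnS.
by move: (f c ^+ (n - i)) (f c ^+ i) (x ^+ i) (f p`_i) => *; ring.
Qed.

(** Multiply the monic equation of [w], of degree [n], by [d ^ n]. Since [w d = b], the leading term
    becomes [b ^ n] and every other term keeps a factor [d]. *)
Lemma integral_fraction_dvd (R : comNzRingType) (L : comNzRingType)
    (f : {rmorphism R -> L}) (b d : R) w :
  injective f -> integralOver f w -> w * f d = f b -> exists e q, b ^+ e = q * d.
Proof.
move=> f_inj [p mon_p /rootP pw] wd.
have szp : (0 < size p)%N by rewrite lt0n size_poly_eq0 monic_neq0.
have lead_p : p`_(size p).-1 = 1 by rewrite -lead_coefE; apply/monicP.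
pose n := (size p).-1.
exists n, (- \sum_(i < n) p`_i * b ^+ i * d ^+ (n - i).-1).
apply: f_inj; rewrite mulNr rmorphN; apply/eqP; rewrite -addr_eq0; apply/eqP.
have sz_fp : size (map_poly f p) = n.+1.
  by rewrite size_map_poly_id0 ?(monicP mon_p) ?rmorph1 ?oner_neq0 // prednK.
have := congr1 (fun y => y * f d ^+ n) pw; rewrite mul0r => <-.
rewrite horner_coef sz_fp big_ord_recr /= coef_map lead_p /= rmorph1 mul1r.
rewrite mulrDl -exprMn wd -rmorphXn [RHS]addrC; congr (_ + _); first by rewrite rmorphXn.
rewrite mulr_suml rmorph_sum mulr_suml; apply: eq_bigr => i _ /=.
have -> : d ^+ n = d ^+ i * d ^+ (n - i).-1 * d.
  by rewrite -exprD -exprSr; congr (_ ^+ _); have := ltn_ord i; lia.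
rewrite coef_map /= !rmorphM !rmorphXn -wd exprMn.
by move: (f d ^+ (_).-1) (w ^+ i) => *; ring.
Qed.

(* Modulo 1 + X g the element X g is -1, so multiplying by a power of X turns
   the left-hand side into a nonzero constant, up to sign. *)
Lemma poly_dvd_const (C : idomainType) (g : {poly C}) (c : C) e N q :
  c != 0 -> (c%:P * g ^+ N) ^+ e = q * (1 + 'X * g) -> g = 0.
Proof.
move=> c0 E; apply/eqP; apply: contraT => g0.
pose d := 1 + 'X * g.
have Xg0 : 'X * g != 0 by rewrite mulf_neq0 ?polyX_eq0.
have sz_Xg : (1 < size ('X * g)%R)%N.
  by rewrite mulrC size_mulX // ltnS lt0n size_poly_eq0.
have sz_d : (1 < size d)%N by rewrite /d addrC size_polyDl // size_poly1.
have [r Er] : exists r, ('X * g) ^+ (N * e) = (-1) ^+ (N * e) + r * d.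
  elim: (N * e)%N => [|m [r Er]]; first by exists 0; rewrite mul0r addr0.
  exists ((-1) ^+ m + 'X * g * r); rewrite !exprS Er mulrDr mulrDl /d; ring.
have {}E : (c ^+ e)%:P * (-1) ^+ (N * e) = (q * 'X ^+ (N * e) - (c ^+ e)%:P * r) * d.
  have : (c ^+ e)%:P * ('X * g) ^+ (N * e) = q * 'X ^+ (N * e) * d.
    rewrite mulrAC -E polyC_exp exprMn exprMn -exprM.
    by move: (_ ^+ e) ('X ^+ _) (g ^+ _) => *; ring.
  by rewrite Er mulrDr mulrA mulrBl => <-; rewrite addrK.
have : size ((c ^+ e)%:P * (-1) ^+ (N * e) : {poly C}) = 1%N.
  by rewrite mulrC -signr_odd; case: odd; rewrite ?expr1 ?expr0 ?mulN1r ?mul1r;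
    rewrite ?size_polyN size_polyC expf_neq0.
rewrite E; have [->|r0] := eqVneq (q * 'X ^+ (N * e) - (c ^+ e)%:P * r) 0.
  by rewrite mul0r size_poly0.
rewrite size_mul //; last by rewrite -size_poly_gt0 ltnW.
rewrite -size_poly_gt0 in r0; move: r0 sz_d; lia.
Qed.

End Integrality.

(** * Existence of a strictly larger prime *)

Section PrimeAbove.
Local Open Scope ring_scope.
Local Open Scope quotient_scope.

(** The product of the leading coefficients of the given equations makes all the elements integral
    at once. *)
Lemma common_denominator (R : idomainType) (L : fieldType) (f : {rmorphism R -> L})
    (xs : seq L) : injective f ->
    (forall x, x \in xs -> exists2 p : {poly R}, p != 0 & root (map_poly f p) x) ->
  exists2 g, g != 0 & forall x, x \in xs -> integralOver f (f g * x).
Proof.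
move=> f_inj; elim: xs => [|x xs IH] alg; first by exists 1; rewrite ?oner_neq0.
have [|g g0 int_g] := IH; first by move=> y ys; apply: alg; rewrite inE ys orbT.
have [p p0 px] := alg x (mem_head _ _).
have c0 : lead_coef p != 0 by rewrite lead_coef_eq0.
have fc0 : f (lead_coef p) != 0 by rewrite -(rmorph0 f) (inj_eq f_inj).
exists (lead_coef p * g); first by rewrite mulf_neq0.
move=> y; rewrite inE rmorphM => /orP[/eqP->|ys].
  by rewrite mulrAC; apply: integral_mul (integral_id _ _); apply: integral_lead_coef.
by rewrite -mulrA; apply: integral_mul (integral_id _ _) _; apply: int_g.
Qed.

(** Scan [gens] once and keep each element that is independent of those kept so far. A rejected
    element stays dependent when the family grows. *)
Lemma greedy_indep (k : fieldType) (A : comNzRingType) (h : {rmorphism k -> A})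
    (P : A -> Prop) (b gens : seq A) : alg_indep h P b ->
  exists e, [/\ subseq e gens, alg_indep h P (b ++ e) &
    forall x, x \in gens -> x \in e \/ ~ alg_indep h P (x :: b ++ e)].
Proof.
elim: gens b => [|x gens IH] b ind_b.
  by exists [::]; rewrite cats0.
have [ind_bx|nind_bx] := pselect (alg_indep h P (rcons b x)).
  have [e [sub_e ind_e max_e]] := IH _ ind_bx.
  exists (x :: e); rewrite -cat_rcons; split=> //=; first by rewrite eqxx.
  move=> y; rewrite inE => /orP[/eqP->|/max_e []]; first by left; rewrite mem_head.
    by move=> ye; left; rewrite inE ye orbT.
  by right.
have [e [sub_e ind_e max_e]] := IH _ ind_b.
exists e; split=> //; first exact: subseq_trans sub_e (subseq_cons _ _).
move=> y; rewrite inE => /orP[/eqP->|/max_e //]; right => ind.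
apply: nind_bx; rewrite -cats1; have := ind.
rewrite -cat1s => {}ind.
apply: (@alg_indep_perm _ _ h P _ (x :: b)); first by rewrite perm_catC.
by apply: alg_indep_subseq ind; rewrite /= eqxx prefix_subseq.
Qed.

Section Step.
Variables (k : fieldType) (A : comNzRingType) (h : {rmorphism k -> A}).
Variable gens : seq A.
Hypothesis gensP : forall a, exists f, a = peval h gens f.

(* With s' a maximal independent extension of s by generators, all generators are
   algebraic over k[s'][t]. If g is a common denominator making them integral,
   then 1 + t g generates an ideal that misses the nonzero elements of k[s']. *)
Lemma prime_above (L : fieldType) (phi : {rmorphism A -> L}) t s :
    alg_indep h (fun x => phi x = 0) (t :: s) ->
  exists q : prime_idealr A, [/\ forall x, phi x = 0 -> x \in q,
    exists2 a, a \in q & phi a != 0 & alg_indep h (fun x => x \in q) s].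
Proof.
case/(greedy_indep gens) => e [_ /=]; set s' := s ++ e => ind max_e.
pose C : idomainType := {mpoly k[size s']}.
(* Since [t :: s'] is independent, evaluation at [t] identifies [{poly C}] with the subring
   [k[s'][t]] of [L]. *)
pose psi : {poly C} -> L := phi \o horner_eval t \o map_poly (peval h s').
pose psiM : {rmorphism {poly C} -> L} := GRing.RMorphism.clone _ _ psi _.
have psi_inj : injective psi.
  move=> p q /eqP; rewrite -subr_eq0 -(rmorphB psiM) => /eqP/(proj1 (alg_indep_cons _ _ _ _) ind).
  by move/eqP; rewrite subr_eq0 => /eqP.
have psiC c : psi c%:P = phi (peval h s' c).
  by rewrite /psi /= map_polyC /horner_eval hornerC.
have gens_alg x : x \in [seq phi y | y <- gens] ->
    exists2 p : {poly {poly C}}, p != 0 & root (map_poly psiM p) x.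
  case/mapP => y /max_e [ye|nind] ->.
    (* A generator kept in [e] is a variable of [C], hence a root of a linear polynomial. *)
    have /(nthP 0)[j lt_j <-] : y \in s' by rewrite mem_cat ye orbT.
    exists ('X - ('X_(Ordinal lt_j) : C)%:P%:P); first by rewrite polyXsubC_eq0.
    by rewrite map_polyXsubC root_XsubC -[psiM _]/(psi _) psiC pevalX.
  (* A rejected generator satisfies a relation over [k[t :: s']]; [msplit] rewrites its coefficients
     as polynomials in [t] over [C]. *)
  have [q qy q0] : exists2 q, phi ((map_poly (peval h (t :: s')) q).[y]) = 0 & q <> 0.
    apply: contrapT => no_q; apply: nind; apply/alg_indep_cons => q qy.
    by apply: contrapT => q0; apply: no_q; exists q.
  have msplit_inj := can_inj (@msplitK (size s') k).
  exists (map_poly (@msplit (size s') k) q).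
    apply: contra_notN q0 => /eqP Eq; apply/polyP => i; apply: msplit_inj.
    by rewrite -coef_map /= Eq !coef0 rmorph0.
  rewrite rootE -map_poly_comp -qy -horner_map -map_poly_comp.
  rewrite (_ : map_poly _ _ = map_poly (phi \o peval h (t :: s')) q) //.
  apply: eq_map_poly => c /=; rewrite /psi /= -[in RHS](msplitK c).
  by rewrite peval_mjoin.
have [g g0 int_g] := common_denominator psi_inj gens_alg.
pose d : {poly C} := 1 + 'X * g.
(* As [u] is a polynomial in the generators, some [g ^ N] makes it integral over [k[s'][t]]. If
   [u d = c], then [d] divides a power of [c g ^ N], and [poly_dvd_const] gives [g = 0]. *)
have no_unit c u : c != 0 -> phi u * psi d <> psi c%:P.
  move=> c0 Eu.
  have [N int_u] : exists N, integralOver psiM (psi g ^+ N * phi u).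
    have [f ->] := gensP u.
    elim/mpoly_ring_ind: f => [a|i|p q [N1 i1] [N2 i2]|p q [N1 i1] [N2 i2]].
    - exists 0%N; rewrite mul1r pevalC.
      have -> : phi (h a) = psiM (a%:MP : C)%:P by rewrite -[psiM _]/(psi _) psiC pevalC.
      exact: integral_id.
    - by exists 1%N; rewrite pevalX; apply: int_g; apply/map_f/mem_nth.
    - exists (N1 + N2)%N; rewrite !rmorphD /= mulrDr; apply: integral_add.
        by rewrite exprD mulrAC [X in integralOver _ X]mulrC -(rmorphXn psiM);
          apply: integral_mul i1; apply: integral_id.
      by rewrite exprD -mulrA -(rmorphXn psiM); apply: integral_mul i2; apply: integral_id.
    - exists (N1 + N2)%N; rewrite !rmorphM /= exprD mulrACA; exact: integral_mul.
  have [|e0 [q]] := integral_fraction_dvd (f := psiM) (b := c%:P * g ^+ N) (d := d) psi_inj int_u.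
    by rewrite -mulrA Eu rmorphM rmorphXn mulrC.
  by move/poly_dvd_const => /(_ c0) g00; rewrite g00 eqxx in g0.
(* Avoiding [S] keeps [s'] independent modulo the prime, and containing [I] puts [1 + t g] in it,
   which makes the inclusion strict. *)
pose S x := exists2 c : C, c != 0 & x = peval h s' c.
pose I x := exists u, phi x = phi u * psi d.
have [||||||q Iq Sq] := @avoiding_prime A S I.
- by exists 1; rewrite ?oner_neq0 // rmorph1.
- by move=> _ _ [c c0 ->] [c' c0' ->]; exists (c * c'); rewrite ?mulf_neq0 ?rmorphM.
- by exists 0; rewrite !rmorph0 mul0r.
- by move=> x y [u Eu] [v Ev]; exists (u + v); rewrite !rmorphD Eu Ev mulrDl.
- by move=> a x [u Eu]; exists (a * u); rewrite !rmorphM Eu mulrA.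
- by move=> x [u Eu] [c c0 Ec]; apply: (no_unit c u c0); rewrite -Eu Ec psiC.
exists q; split.
- by move=> x x0; apply: Iq; exists 0; rewrite x0 rmorph0 mul0r.
- exists (map_poly (peval h s') d).[t]; first by apply: Iq; exists 1; rewrite rmorph1 mul1r.
  rewrite -[phi _]/(psi d) -(rmorph0 psiM) (inj_eq psi_inj).
  (* The polynomial [d] is nonzero because its value at 0 is 1. *)
  apply/eqP => d0; have : d.[0] = 1 by rewrite /d !hornerE.
  by rewrite d0 horner0 => /eqP; rewrite eq_sym oner_eq0.
- apply: alg_indep_subseq (prefix_subseq s e) _ => c qc.
  by apply/eqP; apply: contraT => c0; case: (Sq _ qc); exists c.
Qed.

End Step.
End PrimeAbove.

(** * Krull dimension as transcendence degree *)

Section Krull.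
Local Open Scope ring_scope.
Local Open Scope quotient_scope.
Variables (k : fieldType).

(** Each entry of [s] is traded for one strict step up by [prime_above]. The induction also records
    that the chain starts at [p], so that [p] can be prepended to a chain starting at the next
    prime. *)
Lemma indep_prime_chain (A : comNzRingType) (h : {rmorphism k -> A}) (gens : seq A) :
    (forall a, exists f, a = peval h gens f) ->
    forall s (p : prime_idealr A), alg_indep h (fun x => x \in p) s ->
  has_prime_chain A (size s).
Proof.
move=> gensP s p ind_s.
suff [q [_ qP]] : exists q : 'I_(size s).+1 -> prime_idealr A, q ord0 = p /\
  forall i j : 'I_(size s).+1, (i < j)%N ->
      {subset q i <= q j} /\ ~ {subset q j <= q i} by exists q.
elim: s p ind_s => [|t s IH] p ind.
  by exists (fun=> p); split=> // i j; rewrite !ord1.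
have [L [phi phiP]] := prime_idealr_kernel p.
have [|r [pr [a ra a0] ind_r]] := prime_above gensP (phi := phi) (t := t) (s := s).
  by apply: alg_indepW ind => x; rewrite -phiP => ->.
have [q [q0 qP]] := IH r ind_r.
have sub_pr : {subset p <= r} by move=> x; rewrite -phiP => /eqP/pr.
have rq i : {subset r <= q i}.
  rewrite -q0; have [->//|i0] := eqVneq i ord0.
  by have [] := qP ord0 i; rewrite // lt0n.
exists (fun i => if unlift ord0 i is Some j then q j else p).
rewrite unlift_none; split=> // i j.
case: (unliftP ord0 i) => [i'|] ->; case: (unliftP ord0 j) => [j'|] -> //.
  by move=> ij; apply: qP.
move=> _; split; first by move=> x /sub_pr; apply: rq.
move/(_ a (rq _ _ ra)); rewrite -phiP; exact/negP.
Qed.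

Section Quotient.
Variables (A : comNzRingType) (h : {rmorphism k -> A}) (gens : seq A).
Hypothesis gensP : forall a, exists f, a = peval h gens f.
Variables (L : fieldType) (phi : {rmorphism A -> L}).
Variables (J : idealr A).
Hypothesis JP : forall x, (x \in J) = (phi x == 0).
Local Notation Q := {ideal_quot J}.

Let phiQ (x : Q) : L := phi (repr x).

Let phiQ_pi a : phiQ (\pi_Q a) = phi a.
Proof.
apply/eqP; rewrite -subr_eq0 -rmorphB -JP Quotient.idealrBE.
by apply/eqP; rewrite reprK.
Qed.

Let phiQ_zmod : zmod_morphism phiQ.
Proof.
by move=> x y; rewrite -(reprK x) -(reprK y) -rmorphB /= !phiQ_pi rmorphB.
Qed.

Let phiQ_monoid : monoid_morphism phiQ.
Proof.
split=> [|x y]; first by rewrite -(rmorph1 (\pi_Q)) phiQ_pi rmorph1.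
by rewrite -(reprK x) -(reprK y) -rmorphM /= !phiQ_pi rmorphM.
Qed.

Lemma krull_dim_alg_indep d :
  krull_dim Q d <->
  (exists2 s, size s = d & alg_indep h (fun x => phi x = 0) s) /\
  (forall s, alg_indep h (fun x => phi x = 0) s -> (size s <= d)%N).
Proof.
pose f1 := GRing.isZmodMorphism.Build Q L phiQ phiQ_zmod.
pose f2 := GRing.isMonoidMorphism.Build Q L phiQ phiQ_monoid.
pose f : {rmorphism Q -> L} := HB.pack phiQ f1 f2.
pose piM : {rmorphism A -> Q} := \pi_Q.
pose hQ : {rmorphism k -> Q} := piM \o h.
have chain_indep n : has_prime_chain Q n ->
    exists2 s, size s = n & alg_indep h (fun x => phi x = 0) s.
  case/(prime_chain_indep hQ) => s szs ind; exists (map repr s); first by rewrite size_map.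
  have {}ind : alg_indep (piM \o h) (fun x => x = 0) (map piM (map repr s)).
    by rewrite mapK //; exact: reprK.
  move/(alg_indep_rmorph h piM): ind; apply: alg_indepW => x x0.
  by apply/eqP; rewrite -(rmorph0 (\pi_Q)) -Quotient.idealrBE subr0 JP x0.
have indep_chain s : alg_indep h (fun x => phi x = 0) s -> has_prime_chain Q (size s).
  move=> ind; rewrite -(size_map piM).
  have gensQ a : exists g, a = peval hQ (map piM gens) g.
    have [g Eg] := gensP (repr a); have [g' Eg'] := peval_map h piM g.
    by exists g'; rewrite -Eg' -Eg /= reprK.
  (* The chain starts at the zero ideal of [Q], presented as the kernel of the embedding [f]. *)
  apply: (indep_prime_chain gensQ (p := kernel f : prime_idealr Q)).
  apply/(alg_indep_rmorph h piM (fun x => x \in kernel f)).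
  by apply: alg_indepW ind => x; rewrite unfold_in /kernel /= phiQ_pi => /eqP.
split=> [[/chain_indep ex_s max_d]|[[s <- ind_s] max_d]].
  by split=> // s /indep_chain/max_d.
split; first exact: indep_chain.
by move=> n /chain_indep[t <- /max_d].
Qed.

End Quotient.
End Krull.

(** * Algebraic closure and the Steinitz exchange lemma *)

Section Fractions.
Local Open Scope ring_scope.
Local Open Scope quotient_scope.

Local Notation "x %:F" := (@tofrac _ x).

Lemma fracE (R : idomainType) (x : {fraction R}) :
  exists n d, d != 0 /\ x = n%:F / d%:F.
Proof.
elim/quotW: x => r; exists (frac r).1, (frac r).2; split; first exact: denom_ratioP.
have d0 : (frac r).2%:F != 0 by rewrite tofrac_eq0 denom_ratioP.
apply: (canRL (mulfK d0)); unlock tofrac.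
rewrite -[LHS]FracField.pi_mul; apply/eqmodP; rewrite /= FracField.equivfE /FracField.mulf.
by rewrite !numden_Ratio ?mulf_neq0 ?oner_neq0 ?denom_ratioP // !mulr1 mulrC.
Qed.

Lemma frac_extend (R : idomainType) (L : fieldType) (f : {rmorphism R -> L}) :
  (forall x, f x = 0 -> x = 0) ->
  exists F : {rmorphism {fraction R} -> L}, forall x, F x%:F = f x.
Proof.
move=> f_inj.
have f0 d : d != 0 -> f d != 0 by apply: contra_neq; apply: f_inj.
(* A numerator and a denominator are chosen for every fraction; [FE] shows that the value of [F]
   does not depend on the choice. *)
pose num (x : {fraction R}) := projT1 (cid (fracE x)).
pose den (x : {fraction R}) := projT1 (cid (projT2 (cid (fracE x)))).
have numden x : den x != 0 /\ x = (num x)%:F / (den x)%:F.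
  by rewrite /den /num; case: cid => n /= e; case: cid.
pose F x := f (num x) / f (den x).
have FE n d : d != 0 -> F (n%:F / d%:F) = f n / f d.
  move=> d0; pose x := n%:F / d%:F; have [dx0 /eqP] := numden x.
  rewrite -[F _]/(f (num x) / f (den x)) {1}/x eqr_div ?tofrac_eq0 // -!tofracM tofrac_eq => /eqP E.
  by apply/eqP; rewrite eqr_div ?f0 // -!rmorphM -E mulrC.
have F_zmod : zmod_morphism F.
  move=> x y; have [dx0 ->] := numden x; have [dy0 ->] := numden y.
  rewrite -mulNr addf_div ?tofrac_eq0 // -tofracN -!tofracM -tofracD.
  by rewrite !FE ?mulf_neq0 // rmorphD !rmorphM rmorphN -addf_div ?f0 // mulNr.
have F_monoid : monoid_morphism F.
  split=> [|x y].
    by rewrite -[1]divr1 -tofrac1 FE ?oner_neq0 // divrr ?rmorph1 ?unitr1.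
  have [dx0 ->] := numden x; have [dy0 ->] := numden y.
  by rewrite mulf_div -!tofracM !FE ?mulf_neq0 // !rmorphM mulf_div.
pose F1 := GRing.isZmodMorphism.Build {fraction R} L F F_zmod.
pose F2 := GRing.isMonoidMorphism.Build {fraction R} L F F_monoid.
exists (HB.pack F F1 F2 : {rmorphism {fraction R} -> L}) => x /=.
by rewrite -[x%:F]divr1 -tofrac1 FE ?oner_neq0 // rmorph1 divr1.
Qed.

Lemma frac_poly_denom (R : idomainType) (q : {poly {fraction R}}) :
  exists2 d, d != 0 & exists q' : {poly R}, map_poly (@tofrac R) q' = d%:F *: q.
Proof.
elim/poly_ind: q => [|q c [d d0 [q' Eq]]].
  by exists 1; rewrite ?oner_neq0 //; exists 0; rewrite rmorph0 scaler0.
have [n [d1 [d10 ->]]] := fracE c.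
exists (d * d1); first by rewrite mulf_neq0.
exists (d1 *: q' * 'X + (d * n)%:P).
rewrite rmorphD rmorphM /= map_polyX map_polyC /= map_polyZ /= Eq.
rewrite !scalerDr -!scalerAl !scalerA -tofracM [d1 * d]mulrC; congr (_ + _).
rewrite -mul_polyC -polyCM !tofracM -!mulrA; congr ((_ * _)%:P).
by rewrite mulrCA divff ?mulr1 // tofrac_eq0.
Qed.

End Fractions.

Section Closure.
Local Open Scope ring_scope.
Section Def.
Variables (k : fieldType) (L : fieldType) (h : {rmorphism k -> L}).
Implicit Types (s t u w : seq L).

(* The elements of L algebraic over k(s). The inductive form makes transitivity
   immediate; that nothing else gets in is alg_closure_dep. *)
Inductive alg_closure s : L -> Prop :=
| AlgClosureBase c : alg_closure s (h c)
| AlgClosureGen x : x \in s -> alg_closure s x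
| AlgClosureD x y : alg_closure s x -> alg_closure s y -> alg_closure s (x + y)
| AlgClosureM x y : alg_closure s x -> alg_closure s y -> alg_closure s (x * y)
| AlgClosureRoot (p : {poly L}) x : (forall i : nat, alg_closure s p`_i) -> p != 0 ->
    root p x -> alg_closure s x.

Local Notation indep := (alg_indep h (fun x => x = 0)).

Lemma alg_closureS s t x : (forall y, y \in s -> alg_closure t y) ->
  alg_closure s x -> alg_closure t x.
Proof.
move=> st; elim=> [c|y /st //|y z _ ty _ tz|y z _ ty _ tz|p y _ tp p0 py].
- exact: AlgClosureBase.
- exact: AlgClosureD.
- exact: AlgClosureM.
- exact: AlgClosureRoot py.
Qed.

Lemma alg_closure_sub s t x : {subset s <= t} -> alg_closure s x -> alg_closure t x.
Proof. by move=> st; apply: alg_closureS => y /st; apply: AlgClosureGen. Qed.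

Lemma alg_closureB s x y : alg_closure s x -> alg_closure s y -> alg_closure s (x - y).
Proof.
move=> sx sy; apply: AlgClosureD => //; rewrite -mulN1r -(rmorph1 h) -rmorphN.
by apply: AlgClosureM => //; apply: AlgClosureBase.
Qed.

Lemma alg_closureV s x : alg_closure s x -> alg_closure s x^-1.
Proof.
move=> sx; have [-> //|x0] := eqVneq x 0.
  by rewrite invr0 -(rmorph0 h); apply: AlgClosureBase.
apply: (AlgClosureRoot (p := x *: 'X - 1)).
- move=> i; rewrite coefB coefZ coefX coef1.
  case: i => [|[|i]]; rewrite ?mulr0 ?mulr1 ?sub0r ?subr0 ?oppr0 //=.
    by rewrite -(rmorph1 h) -rmorphN; apply: AlgClosureBase.
  by rewrite -(rmorph0 h); apply: AlgClosureBase.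
- apply/eqP => /(congr1 (fun p : {poly L} => p`_1)); rewrite coefB coefZ coefX coef1 coef0.
  by rewrite mulr1 subr0 => x00; rewrite x00 eqxx in x0.
- by rewrite rootE !hornerE divff ?subrr.
Qed.

Lemma alg_closure_peval s t g : {subset s <= t} -> alg_closure t (peval h s g).
Proof.
move=> st; elim/mpoly_ring_ind: g => [c|i|p q cp cq|p q cp cq].
- by rewrite pevalC; apply: AlgClosureBase.
- by rewrite pevalX; apply/AlgClosureGen/st/mem_nth.
- by rewrite rmorphD; apply: AlgClosureD.
- by rewrite rmorphM; apply: AlgClosureM.
Qed.

Lemma dep_alg_closure s x : indep s -> ~ indep (x :: s) -> alg_closure s x.
Proof.
move=> ind_s; apply: contra_notP => ncl; apply/alg_indep_cons => q qx.
apply: contrapT => q0; apply: ncl.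
apply: (AlgClosureRoot (p := map_poly (peval h s) q)); last exact/rootP.
  by move=> i; rewrite coef_map; apply: alg_closure_peval.
apply: contra_notN q0 => /eqP Eq; apply/polyP => i; rewrite coef0; apply: ind_s.
by have := congr1 (fun p : {poly L} => p`_i) Eq; rewrite coef_map coef0.
Qed.

(** Independence of [s] embeds [k(s)] in [L] by [F], and induction shows that the closure is
    algebraic over this field. Clearing denominators in an equation of [x] then gives a relation
    over [k[s]]. *)
Lemma alg_closure_dep s x : indep s -> alg_closure s x -> ~ indep (x :: s).
Proof.
move=> ind_s clx /alg_indep_cons ind_x.
have [F FE] := frac_extend ind_s.
have : algebraicOver F x.
  elim: clx => [c|y /(nthP 0)[i lt_i <-]|y z _ ay _ az|y z _ ay _ az|p y _ ap p0 py].
  - by rewrite -(pevalC h s c) -FE; apply: algebraic_id.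
  - by rewrite -[i]/(val (Ordinal lt_i)) -(pevalX h) -FE; apply: algebraic_id.
  - exact: algebraic_add.
  - exact: algebraic_mul.
  - apply/integral_algebraic.
    have l0 : lead_coef p != 0 by rewrite lead_coef_eq0.
    apply: (integral_root_monic (p := (lead_coef p)^-1 *: p)).
    + by rewrite monicE lead_coefZ mulVf.
    + by rewrite rootZ ?invr_eq0.
    + apply/integral_poly => i; rewrite coefZ; apply/integral_algebraic.
      by apply: algebraic_mul => //; apply: algebraic_inv; rewrite lead_coefE.
case=> q q0 qx; have [d d0 [q' Eq']] := frac_poly_denom q.
have q'0 : q' = 0.
  apply: ind_x; have -> : map_poly (peval h s) q' = map_poly F (map_poly (@tofrac _) q').
    by rewrite -map_poly_comp; apply: eq_map_poly => c /=; rewrite FE.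
  by rewrite Eq' map_polyZ hornerZ (rootP qx) mulr0.
move/eqP: Eq'; rewrite q'0 rmorph0 eq_sym scaler_eq0 tofrac_eq0.
by rewrite (negbTE d0) (negbTE q0).
Qed.

Lemma indep_cat_or_dep s w : indep s ->
  indep (s ++ w) \/ exists w1 z w2, w = w1 ++ z :: w2 /\ alg_closure (s ++ w1) z.
Proof.
move=> ind_s; elim/last_ind: w => [|w z [ind|]]; first by left; rewrite cats0.
  have [ind'|nind] := pselect (indep (z :: s ++ w)).
    left; rewrite -rcons_cat; apply: alg_indep_perm ind'.
    by rewrite perm_rcons.
  right; exists w, z, [::]; rewrite cats1; split=> //.
  exact: dep_alg_closure.
case=> w1 [y [w2 [-> cy]]]; right; exists w1, y, (rcons w2 z).
by rewrite rcons_cat.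
Qed.

(* In the induction, v collects the elements of u already exchanged. *)
Lemma steinitz s u : indep u -> (forall x, x \in u -> alg_closure s x) ->
  (size u <= size s)%N.
Proof.
suff H v : indep (u ++ v) -> (forall x, x \in u -> alg_closure (v ++ s) x) ->
    (size u <= size s)%N by move=> *; apply: (H [::]); rewrite ?cats0.
elim: u v s => [//|y u IH] v s ind span.
have ind_yv : indep (y :: v).
  by apply: alg_indep_subseq ind; rewrite /= eqxx suffix_subseq.
have [ind_s|[s1 [z [s2 [def_s cz]]]]] := indep_cat_or_dep s ind_yv.
  have ind_vs : indep (v ++ s) by apply: alg_indep_subseq ind_s; exact: subseq_cons.
  by case: (alg_closure_dep ind_vs (span y (mem_head _ _)) ind_s).
rewrite def_s size_cat /= addnS ltnS -size_cat; apply: (IH (y :: v)).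
  by apply: alg_indep_perm ind; rewrite perm_catC /= perm_cons perm_catC.
move=> x ux; have := span x; rewrite inE ux orbT => /(_ isT).
apply: alg_closureS => {ux}x; rewrite def_s !(mem_cat, inE).
case/or4P => [vx|s1x|/eqP->|s2x].
- by apply: AlgClosureGen; rewrite inE mem_cat vx orbT.
- by apply: AlgClosureGen; rewrite inE !mem_cat s1x !orbT.
- apply: alg_closure_sub cz => x'; rewrite /= !inE !mem_cat.
  by case/or3P => ->; rewrite ?orbT.
- by apply: AlgClosureGen; rewrite inE !mem_cat s2x !orbT.
Qed.

End Def.
End Closure.

(** * Dimension over a field of rational functions *)

Section Dimension.
Local Open Scope ring_scope.

Local Notation indep h := (alg_indep h (fun x => x = 0)).

Lemma mpoly_gensP (k : fieldType) n (a : {mpoly k[n]}) :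
  exists g, a = peval (@mpolyC n k) [seq 'X_i | i <- enum 'I_n] g.
Proof.
have {1}<- : mmap (@mpolyC n k) (fun i => 'X_i) a = a.
  apply: (mpoly_rmorph_eq (f := mmap (@mpolyC n k) (fun i => 'X_i)) (g := idfun)) => [c|i] /=.
    by rewrite mmapC.
  by rewrite mmapX mmap1U.
apply: mmap_peval => [|i]; first by rewrite size_map size_enum_ord.
by rewrite (nth_map i) ?size_enum_ord // nth_ord_enum.
Qed.

Lemma krull_dim_quot_basis (k : fieldType) n (L : fieldType)
    (phi : {rmorphism {mpoly k[n]} -> L}) (I : {mpoly k[n]} -> Prop) :
  (forall x, I x <-> phi x = 0) ->
  let h := phi \o @mpolyC n k in
  exists e, [/\ subseq e [seq phi 'X_i | i <- enum 'I_n],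
    indep h e, forall x, alg_closure h e (phi x) &
    forall d, krull_dim_quot I d <-> d = size e].
Proof.
move=> IP h; pose gens : seq {mpoly k[n]} := [seq 'X_i | i <- enum 'I_n].
have ind0 : indep h [::].
  by apply: alg_indep_nil => [/eqP|a x ->]; rewrite ?oner_eq0 ?mulr0.
have [e [sub_e ind_e max_e]] := greedy_indep (map phi gens) ind0.
have [s def_e] : exists s, e = map phi s.
  by case/subseqP: (sub_e) => m _ ->; exists (mask m gens); rewrite map_mask.
rewrite -map_comp in sub_e.
have clos x : alg_closure h e (phi x).
  elim/mpoly_ring_ind: x => [c|i|p q cp cq|p q cp cq].
  - exact: AlgClosureBase.
  - have /max_e [ie|] : phi 'X_i \in map phi gens by do 2!apply: map_f; rewrite mem_enum.
      exact: AlgClosureGen.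
    exact: dep_alg_closure.
  - by rewrite rmorphD; apply: AlgClosureD.
  - by rewrite rmorphM; apply: AlgClosureM.
have dimP d : (exists2 s, size s = d & alg_indep (@mpolyC n k) (fun x => phi x = 0) s) /\
    (forall s, alg_indep (@mpolyC n k) (fun x => phi x = 0) s -> (size s <= d)%N)
    <-> d = size e.
  have bound t : alg_indep (@mpolyC n k) (fun x => phi x = 0) t -> (size t <= size e)%N.
    move=> ind_t; rewrite -(size_map phi); apply: (@steinitz _ _ h).
      exact/(alg_indep_rmorph (@mpolyC n k) phi (fun x => x = 0)).
    by move=> _ /mapP[x _ ->].
  have ind_s : alg_indep (@mpolyC n k) (fun x => phi x = 0) s.
    by apply/(alg_indep_rmorph (@mpolyC n k) phi (fun x => x = 0)); rewrite -def_e.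
  split=> [[[t <- ind_t] max_t]|->]; last first.
    by split=> //; exists s; rewrite // def_e size_map.
  by apply/eqP; rewrite eqn_leq bound // def_e size_map max_t.
exists e; split=> // d; split.
  case=> J [JP]; move/(krull_dim_alg_indep (@mpoly_gensP k n) (phi := phi)).
  by move=> dimJ; apply/dimP/dimJ => x; apply/idP/eqP => [/JP/IP|/IP/JP].
move/dimP => dim_d; exists (kernel phi : idealr _); split.
  by move=> x; rewrite unfold_in /kernel; split=> [/IP/eqP|/eqP/IP].
apply/(krull_dim_alg_indep (@mpoly_gensP k n) (phi := phi)) => // x.
Qed.

Section BaseChange.
Variables (k : fieldType) (m : nat) (L : fieldType).
Variables (iota : {rmorphism ratfrac k m -> L}) (h : {rmorphism k -> L}).
Variable xs : 'I_m -> L.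
Hypothesis iotaC : forall c, iota (tofrac (c%:MP : {mpoly k[m]})) = h c.
Hypothesis iotaX : forall i, iota (tofrac ('X_i : {mpoly k[m]})) = xs i.

Local Notation X := [seq xs i | i <- enum 'I_m].

Lemma iota_alg_closure s c : alg_closure h (s ++ X) (iota c).
Proof.
have [p [q [_ ->]]] := fracE c.
have clp (r : {mpoly k[m]}) : alg_closure h (s ++ X) (iota (tofrac r)).
  elim/mpoly_ring_ind: r => [a|i|a b ca cb|a b ca cb].
  - by rewrite iotaC; apply: AlgClosureBase.
  - by rewrite iotaX; apply: AlgClosureGen; rewrite mem_cat map_f ?orbT ?mem_enum.
  - by rewrite tofracD rmorphD; apply: AlgClosureD.
  - by rewrite tofracM rmorphM; apply: AlgClosureM.
by rewrite rmorphM fmorphV; apply: AlgClosureM => //; apply: alg_closureV.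
Qed.

Lemma alg_closure_base s x : alg_closure iota s x <-> alg_closure h (s ++ X) x.
Proof.
split; elim=> [c|y sy|y z _ cy _ cz|y z _ cy _ cz|p y _ cp p0 py].
- exact: iota_alg_closure.
- by apply: AlgClosureGen; rewrite mem_cat sy.
- exact: AlgClosureD.
- exact: AlgClosureM.
- exact: AlgClosureRoot py.
- by rewrite -iotaC; apply: AlgClosureBase.
- move: sy; rewrite mem_cat => /orP[sy|/mapP[i _ ->]]; first exact: AlgClosureGen.
  by rewrite -iotaX; apply: AlgClosureBase.
- exact: AlgClosureD.
- exact: AlgClosureM.
- exact: AlgClosureRoot py.
Qed.

Lemma alg_indep_base s : indep iota s -> indep h (s ++ X).
Proof.
elim: s => [_|x s IH ind] /=.
  apply/alg_indep_enumP => g g0.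
  apply/eqP; rewrite -(tofrac_eq0 g) -(fmorph_eq0 iota) -g0; apply/eqP.
  apply: (mpoly_rmorph_eq (f := iota \o @tofrac {mpoly k[m]}) (g := mmap h xs)) => [c|i] /=.
    by rewrite mmapC iotaC.
  by rewrite mmapX mmap1U iotaX.
have ind_s : indep iota s by apply: alg_indep_subseq ind; apply: subseq_cons.
apply: contrapT => dep; case: (alg_closure_dep ind_s _ ind).
by apply/alg_closure_base/dep_alg_closure => //; apply: IH.
Qed.

End BaseChange.
End Dimension.

Section Generic.
Local Open Scope ring_scope.

Local Notation indep h := (alg_indep h (fun x => x = 0)).

Lemma ideal_gen_mem (A : comNzRingType) (S : A -> Prop) a g :
  S g -> ideal_gen S (a * g).
Proof.
move=> Sg; exists 1%N, (fun=> a), (fun=> g); split=> //.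
by rewrite big_ord1.
Qed.

Lemma ideal_genD (A : comNzRingType) (S : A -> Prop) x y :
  ideal_gen S x -> ideal_gen S y -> ideal_gen S (x + y).
Proof.
case=> n1 [a1 [g1 [S1 ->]]] [n2 [a2 [g2 [S2 ->]]]].
pose cat (u : 'I_n1 -> A) v (i : 'I_(n1 + n2)) :=
  match split i with inl j => u j | inr j => v j end.
exists (n1 + n2)%N, (cat a1 a2), (cat g1 g2); split.
  by move=> i; rewrite /cat; case: split.
rewrite big_split_ord /=; congr (_ + _); apply: eq_bigr => i _; rewrite /cat.
  by rewrite (unsplitK (inl i : 'I_n1 + 'I_n2)).
by rewrite (unsplitK (inr i : 'I_n1 + 'I_n2)).
Qed.

Lemma ideal_genM (A : comNzRingType) (S : A -> Prop) a x :
  ideal_gen S x -> ideal_gen S (a * x).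
Proof.
case=> n [b [g [Sg ->]]]; exists n, (fun i => a * b i), g; split=> //.
by rewrite mulr_sumr; apply: eq_bigr => i _; rewrite mulrA.
Qed.

Lemma ideal_gen_congrM (A : comNzRingType) (S : A -> Prop) x x' y y' :
  ideal_gen S (x - x') -> ideal_gen S (y - y') -> ideal_gen S (x * y - x' * y').
Proof.
move=> Sx Sy; have -> : x * y - x' * y' = y * (x - x') + x' * (y - y') by ring.
by apply: ideal_genD; apply: ideal_genM.
Qed.

Lemma ideal_gen0 (A : comNzRingType) (S : A -> Prop) : ideal_gen S 0.
Proof.
have S0 (i : 'I_0) : S 0 by case: i.
by exists 0%N, (fun=> 0), (fun=> 0); rewrite big_ord0.
Qed.

Lemma ideal_gen_ker (A B : comNzRingType) (f : {rmorphism A -> B}) (S : A -> Prop) x :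
  (forall y, S y -> f y = 0) -> ideal_gen S x -> f x = 0.
Proof.
move=> S0 [n [a [g [Sg ->]]]]; rewrite rmorph_sum big1 // => i _.
by rewrite rmorphM (S0 _ (Sg i)) mulr0.
Qed.

Section Blocks.
Variables (K : fieldType) (m n : nat).

HB.instance Definition _ := 
  GRing.RMorphism.copy (@emb_left K m n)
    (comp_mpoly [tuple 'X_(lshift n i) | i < m]).
HB.instance Definition _ := 
  GRing.RMorphism.copy (@emb_right K m n)
    (comp_mpoly [tuple 'X_(rshift m j) | j < n]).
HB.instance Definition _ := 
  GRing.RMorphism.copy (@to_generic K m n)
    (mmap (@mpolyC n (ratfrac K m) \o @tofrac {mpoly K[m]} \o @mpolyC m K)
       (fun k => match split k with
                 | inl i => (tofrac ('X_i : {mpoly K[m]}) : ratfrac K m)%:MP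
                 | inr j => 'X_j
                 end)).

Lemma emb_leftC c : emb_left n (c%:MP : {mpoly K[m]}) = c%:MP.
Proof. by rewrite [LHS]mmapC. Qed.

Lemma emb_leftX i : emb_left n ('X_i : {mpoly K[m]}) = 'X_(lshift n i).
Proof. by rewrite /emb_left comp_mpolyXU -tnth_nth tnth_mktuple. Qed.

Lemma emb_rightC c : emb_right m (c%:MP : {mpoly K[n]}) = c%:MP.
Proof. by rewrite [LHS]mmapC. Qed.

Lemma emb_rightX i : emb_right m ('X_i : {mpoly K[n]}) = 'X_(rshift m i).
Proof. by rewrite /emb_right comp_mpolyXU -tnth_nth tnth_mktuple. Qed.

Lemma to_genericC c : to_generic m n (c%:MP) = (tofrac (c%:MP : {mpoly K[m]}))%:MP.
Proof. by rewrite /to_generic mmapC. Qed.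

Lemma to_genericX_l i :
  to_generic m n 'X_(lshift n i) = (tofrac ('X_i : {mpoly K[m]}))%:MP.
Proof.
by rewrite /to_generic mmapX mmap1U (unsplitK (inl i : 'I_m + 'I_n)).
Qed.

Lemma to_genericX_r j :
  to_generic m n ('X_(rshift m j) : {mpoly K[m + n]}) = 'X_j.
Proof.
by rewrite /to_generic mmapX mmap1U (unsplitK (inr j : 'I_m + 'I_n)).
Qed.

Lemma to_generic_emb_left (f : {mpoly K[m]}) : to_generic m n (emb_left n f) = (tofrac f)%:MP.
Proof.
apply: (mpoly_rmorph_eq (f := @to_generic K m n \o @emb_left K m n)
  (g := @mpolyC n (ratfrac K m) \o @tofrac {mpoly K[m]})) => [c|i] /=.
  by rewrite emb_leftC to_genericC.
by rewrite emb_leftX to_genericX_l.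
Qed.

Lemma clear_denominators (F : {mpoly ratfrac K m[n]}) :
  exists c F', c != 0 :> {mpoly K[m]} /\ (tofrac c)%:MP * F = to_generic m n F'.
Proof.
elim/mpoly_ring_ind: F => [a|j|F G [c [F' [c0 EF]]] [d [G' [d0 EG]]]|
    F G [c [F' [c0 EF]]] [d [G' [d0 EG]]]].
- have [p [q [q0 ->]]] := fracE a; exists q, (emb_left n p); split=> //.
  by rewrite to_generic_emb_left -mpolyCM mulrC divfK // tofrac_eq0.
- exists 1, 'X_(rshift m j); split; first exact: oner_neq0.
  by rewrite tofrac1 mpolyC1 mul1r to_genericX_r.
- exists (c * d), (emb_left n d * F' + emb_left n c * G'); split; first exact: mulf_neq0.
  rewrite tofracM mpolyCM rmorphD !rmorphM /= -EF -EG !to_generic_emb_left.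
  by move: (_%:MP) (_%:MP) => *; ring.
- exists (c * d), (F' * G'); split; first exact: mulf_neq0.
  by rewrite tofracM mpolyCM rmorphM /= -EF -EG mulrACA.
Qed.

Variables (L : fieldType) (phi : {rmorphism {mpoly K[m + n]} -> L}).
Hypothesis phi_inj : forall f, phi (emb_left n f) = 0 -> f = 0.

Lemma generic_extension : exists psi : {rmorphism {mpoly ratfrac K m[n]} -> L},
  forall x, psi (to_generic m n x) = phi x.
Proof.
have [F FE] : exists F : {rmorphism ratfrac K m -> L},
    forall x : {mpoly K[m]}, F (tofrac x) = phi (emb_left n x).
  exact: (frac_extend (f := phi \o @emb_left K m n) phi_inj).
pose v j := phi 'X_(rshift m j).
exists (mmap F v) => x.
apply: (mpoly_rmorph_eq (f := mmap F v \o @to_generic K m n)) => [c|i] /=.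
  by rewrite to_genericC mmapC /= FE emb_leftC.
case: (split_ordP i) => j ->.
  by rewrite to_genericX_l mmapC /= FE emb_leftX.
by rewrite to_genericX_r mmapX mmap1U.
Qed.

Lemma generic_dimension (I : {mpoly K[m + n]} -> Prop) :
  (forall x, I x <-> phi x = 0) ->
  let h := phi \o @mpolyC (m + n) K in
  let X := [seq phi 'X_(lshift n i) | i <- enum 'I_m] in
  exists e, [/\ subseq e [seq phi 'X_(rshift m j) | j <- enum 'I_n],
    indep h (e ++ X), forall x, alg_closure h (e ++ X) (phi x) &
    forall d, krull_dim_quot (ideal_ext (to_generic m n) I) d <-> d = size e].
Proof.
move=> IP h X; have [psi psiE] := generic_extension.
have kerP x : ideal_ext (to_generic m n) I x <-> psi x = 0.
  split.
    by apply: ideal_gen_ker => _ [y /IP y0 ->]; rewrite psiE.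
  move=> x0; have [c [F [c0 E]]] := clear_denominators x.
  have -> : x = (tofrac c)^-1%:MP * to_generic m n F.
    by rewrite -E mulrA -mpolyCM mulVf ?mpolyC1 ?mul1r // tofrac_eq0.
  apply: ideal_gen_mem; exists F => //; apply/IP.
  by rewrite -psiE -E rmorphM x0 mulr0.
have [e [sub_e ind_e clos dimE]] := krull_dim_quot_basis kerP.
pose iota : {rmorphism ratfrac K m -> L} := psi \o @mpolyC n (ratfrac K m).
have iotaC c : iota (tofrac (c%:MP : {mpoly K[m]})) = h c.
  by rewrite /= -to_genericC psiE.
have iotaX i : iota (tofrac ('X_i : {mpoly K[m]})) = phi 'X_(lshift n i).
  by rewrite /= -to_genericX_l psiE.
exists e; split=> //.
- congr (subseq e _): sub_e; apply: eq_map => j.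
  by rewrite -to_genericX_r psiE.
- exact: (alg_indep_base (iota := iota) iotaC iotaX).
- by move=> x; apply/(alg_closure_base (iota := iota) iotaC iotaX); rewrite -psiE; exact: clos.
Qed.

End Blocks.
End Generic.

(** * The generic system *)

Section Specialization.
Local Open Scope ring_scope.

Local Notation indep h := (alg_indep h (fun x => x = 0)).

Lemma eq_alg_indep (k : fieldType) (A : comNzRingType) (h h' : {rmorphism k -> A})
    (P : A -> Prop) s : h =1 h' -> alg_indep h P s -> alg_indep h' P s.
Proof.
move=> hh' ind g; rewrite (_ : peval h' s g = peval h s g); first exact: ind.
apply: (mpoly_rmorph_eq (f := peval h' s) (g := peval h s)) => [c|i] /=.
  by rewrite !pevalC hh'.
by rewrite !pevalX.
Qed.

Lemma alg_closure_rmorph (k L L' : fieldType) (h : {rmorphism k -> L})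
    (h' : {rmorphism k -> L'}) (f : {rmorphism L -> L'}) s x :
  (forall c, f (h c) = h' c) -> alg_closure h s x -> alg_closure h' (map f s) (f x).
Proof.
move=> fh; elim=> [c|y sy|y z _ cy _ cz|y z _ cy _ cz|p y _ cp p0 py].
- by rewrite fh; apply: AlgClosureBase.
- exact/AlgClosureGen/map_f.
- by rewrite rmorphD; apply: AlgClosureD.
- by rewrite rmorphM; apply: AlgClosureM.
- apply: (AlgClosureRoot (p := map_poly f p)); last by rewrite fmorph_root.
    by move=> i; rewrite coef_map; exact: cp.
  by rewrite map_poly_eq0.
Qed.

Section Vars.
Variables (k L : fieldType) (N : nat) (h : {rmorphism k -> L}).

Definition kill_vars (l : seq 'I_N) : {mpoly L[N]} -> {mpoly L[N]} :=
  mmap (@mpolyC N L) (fun i => if i \in l then 0 else 'X_i).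

HB.instance Definition _ l := GRing.RMorphism.copy (kill_vars l)
  (mmap (@mpolyC N L) (fun i => if i \in l then 0 else 'X_i)).

Lemma kill_varsC l c : kill_vars l c%:MP = c%:MP.
Proof. by rewrite /kill_vars mmapC. Qed.

Lemma kill_varsX l i : kill_vars l 'X_i = if i \in l then 0 else 'X_i.
Proof. by rewrite /kill_vars mmapX mmap1U. Qed.

Lemma mpolyX1_neq0 i : ('X_i : {mpoly L[N]}) != 0.
Proof. by rewrite -msupp_eq0 msuppX. Qed.

Let hN : {rmorphism k -> {mpoly L[N]}} := @mpolyC N L \o h.

(* Setting the variables of l to 0 one at a time is a chain of primes, and each
   step adds one independent element by alg_indep_kernel_cons. *)
Lemma alg_indep_vars l s : uniq l -> indep hN (map (kill_vars l) s) ->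
  indep hN ([seq 'X_i | i <- l] ++ s).
Proof.
move=> uniq_l ind; have {}ind : alg_indep hN (fun x => kill_vars l x = 0) s.
  apply/(alg_indep_rmorph hN (kill_vars l) (fun x => x = 0)).
  by apply: eq_alg_indep ind => c; rewrite /= kill_varsC.
elim: l s uniq_l ind => [|i l IH] s /=.
  move=> _; apply: alg_indepW => x ->; exact: rmorph0.
case/andP=> il uniq_l ind.
have {ind} : indep hN ([seq 'X_j | j <- l] ++ 'X_i :: s); last first.
  by apply: alg_indep_perm; rewrite -cat_cons -cat1s -catA perm_catCA.
apply: IH => //.
have kk : kill_vars (i :: l) =1 kill_vars [:: i] \o kill_vars l.
  apply: (mpoly_rmorph_eq (f := kill_vars (i :: l))
    (g := kill_vars [:: i] \o kill_vars l)) => [c|j] /=; first by rewrite !kill_varsC.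
  rewrite !kill_varsX inE; case: (j \in l); first by rewrite orbT rmorph0.
  by rewrite orbF kill_varsX inE.
apply: (alg_indep_kernel_cons (f := kill_vars l) (g := kill_vars (i :: l))) => //.
- by move=> x x0; apply: etrans (kk x) _; rewrite /= x0 rmorph0.
- by apply: etrans (kill_varsX _ _) _; rewrite mem_head.
- by rewrite [X in X != 0](kill_varsX l i) (negbTE il) ?mpolyX1_neq0.
Qed.

End Vars.
End Specialization.

Section System.
Local Open Scope ring_scope.

Local Notation indep h := (alg_indep h (fun x => x = 0)).

Variables (K : fieldType) (r s rho : nat) (hrho : (rho <= r)%N) (D : 'I_rho -> nat).

Local Notation R := {mpoly K[r + s]}.
Local Notation N := #|Lidx s D|.
Local Notation KLTY := {mpoly K[N + (r + s)]}.

Definition exp0 i : 'X_{1..s < (D i).+1} := bm0.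

Definition zero_exponent (u : Lidx s D) : bool := tagged u == exp0 (tag u).

Definition Ymonomial i (b : 'X_{1..s < (D i).+1}) : R :=
  \prod_(j < s) 'X_(rshift r j) ^+ b j.

Definition Lindex i (b : 'X_{1..s < (D i).+1}) : 'I_N :=
  enum_rank (Tagged _ b : Lidx s D).

(* Modulo the equations, the constant coefficient of the i-th generic polynomial
   is T_i minus the other terms; the other coefficients stay free variables. *)
Definition solve_L0 (u : Lidx s D) : {mpoly R[N]} :=
  if zero_exponent u then
    ('X_(lshift s (widen_ord hrho (tag u))))%:MP -
      \sum_(b | b != exp0 (tag u)) 'X_(Lindex b) * (Ymonomial b)%:MP
  else 'X_(enum_rank u).

Definition eliminate : KLTY -> {mpoly R[N]} :=
  mmap (@mpolyC N R \o @mpolyC (r + s) K)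
    (fun k => match split k with
              | inl l => solve_L0 (enum_val l)
              | inr j => ('X_j : R)%:MP
              end).

HB.instance Definition _ := GRing.RMorphism.copy eliminate
  (mmap (@mpolyC N R \o @mpolyC (r + s) K)
    (fun k => match split k with
              | inl l => solve_L0 (enum_val l)
              | inr j => ('X_j : R)%:MP
              end)).

Lemma eliminateC c : eliminate c%:MP = c%:MP%:MP.
Proof. by rewrite /eliminate mmapC. Qed.

Lemma eliminate_l l : eliminate 'X_(lshift (r + s) l) = solve_L0 (enum_val l).
Proof.
by rewrite /eliminate mmapX mmap1U (unsplitK (inl l : 'I_N + 'I_(r + s))).
Qed.

Lemma eliminate_r j : eliminate 'X_(rshift N j) = ('X_j)%:MP.
Proof.
by rewrite /eliminate mmapX mmap1U (unsplitK (inr j : 'I_N + 'I_(r + s))).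
Qed.

Lemma eliminate_emb_right (f : R) : eliminate (emb_right N f) = f%:MP.
Proof.
apply: (mpoly_rmorph_eq (f := eliminate \o @emb_right K N (r + s))
  (g := @mpolyC N R)) => [c|i] /=.
  by rewrite emb_rightC eliminateC.
by rewrite emb_rightX eliminate_r.
Qed.

Definition reinsert : {mpoly R[N]} -> KLTY :=
  mmap (@emb_right K N (r + s)) (fun l => 'X_(lshift (r + s) l)).

HB.instance Definition _ := GRing.RMorphism.copy reinsert
  (mmap (@emb_right K N (r + s)) (fun l => 'X_(lshift (r + s) l))).

Lemma reinsertC f : reinsert f%:MP = emb_right N f.
Proof. by rewrite /reinsert mmapC. Qed.

Lemma reinsertX l : reinsert 'X_l = 'X_(lshift (r + s) l).
Proof. by rewrite /reinsert mmapX mmap1U. Qed.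

Lemma emb_right_Ymonomial i (b : 'X_{1..s < (D i).+1}) :
  emb_right N (Ymonomial b) = \prod_(j < s) Yvar K r D j ^+ b j.
Proof.
rewrite rmorph_prod; apply: eq_bigr => j _.
by rewrite rmorphXn /= emb_rightX.
Qed.

Lemma generic_polyE i : @generic_poly K r s rho D i =
  Lvar K r (exp0 i) +
    \sum_(b | b != exp0 i) Lvar K r b * emb_right N (Ymonomial b).
Proof.
rewrite /generic_poly (bigD1 (exp0 i)) //=; congr (_ + _).
  rewrite big1 ?mulr1 // => j _; rewrite mnm0E expr0 //.
by apply: eq_bigr => b _; rewrite emb_right_Ymonomial.
Qed.

Lemma eliminate_Q i : eliminate (@Qpoly K r s rho D hrho i) = 0.
Proof.
rewrite /Qpoly generic_polyE rmorphB rmorphD rmorph_sum /= /Tvar eliminate_r.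
have Lv b : eliminate (Lvar K r b) = solve_L0 (Tagged _ b : Lidx s D).
  by rewrite /Lvar eliminate_l enum_rankK.
rewrite Lv /solve_L0 /zero_exponent /= eqxx addrAC [_ - _ + _]addrC -!addrA.
rewrite (eq_bigr (fun b => 'X_(Lindex b) * (Ymonomial b)%:MP)); last first.
  by move=> b /negbTE b0; rewrite rmorphM /= eliminate_emb_right Lv /solve_L0 /zero_exponent /= b0.
by ring.
Qed.

Section Kernel.
Variables (p : R -> Prop) (Lp : fieldType) (phi : {rmorphism R -> Lp}).
Hypothesis pP : forall x, p x <-> phi x = 0.

Local Notation P := (PS D p hrho).

Definition system_map : KLTY -> {mpoly Lp[N]} := map_mpoly phi \o eliminate.

HB.instance Definition _ := GRing.RMorphism.on system_map.

Lemma system_map_emb_right f : system_map (emb_right N f) = (phi f)%:MP.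
Proof. by rewrite /system_map /= eliminate_emb_right map_mpolyC. Qed.

Lemma PS_reinsert c : map_mpoly phi c = 0 -> P (reinsert c).
Proof.
move=> c0; rewrite /reinsert /mmap; apply: big_ind => [||m _].
- exact: ideal_gen0.
- exact: ideal_genD.
- rewrite mulrC; apply: ideal_gen_mem; left; exists c@_m => //.
  by apply/pP; rewrite -mcoeff_map_mpoly c0 mcoeff0.
Qed.

Lemma PS_congr x : P (x - reinsert (eliminate x)).
Proof.
elim/mpoly_ring_ind: x => [c|k|x y Px Py|x y Px Py].
- rewrite eliminateC reinsertC emb_rightC subrr; exact: ideal_gen0.
- case: (split_ordP k) => [l|j] ->; last first.
    by rewrite eliminate_r reinsertC emb_rightX subrr; exact: ideal_gen0.
  rewrite eliminate_l /solve_L0; case: ifP => [l0|_]; last first.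
    by rewrite enum_valK reinsertX subrr; exact: ideal_gen0.
  set i := tag (enum_val l).
  suff -> : 'X_(lshift (r + s) l) - reinsert (('X_(lshift s (widen_ord hrho i)) : R)%:MP -
      \sum_(b | b != exp0 i) 'X_(Lindex b) * (Ymonomial b)%:MP) =
      1 * @Qpoly K r s rho D hrho i.
    by apply: ideal_gen_mem; right; exists i.
  rewrite mul1r /Qpoly generic_polyE rmorphB rmorph_sum /= reinsertC emb_rightX.
  have -> : Lvar K r (exp0 i) = 'X_(lshift (r + s) l).
    rewrite /Lvar; congr ('X_(lshift _ _)); rewrite -(enum_valK l); congr enum_rank.
    by move: l0; rewrite /zero_exponent /i; case: (enum_val l) => a b /= /eqP->.
  rewrite (eq_bigr (fun b => Lvar K r b * emb_right N (Ymonomial b))); last first.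
    by move=> b _; rewrite rmorphM /= reinsertC reinsertX.
  by rewrite /Tvar; ring.
- rewrite (rmorphD eliminate) (rmorphD reinsert) opprD addrACA.
  exact: (ideal_genD Px Py).
- rewrite (rmorphM eliminate) (rmorphM reinsert) /=.
  exact: (ideal_gen_congrM Px Py).
Qed.

Lemma PS_kernel x : P x <-> system_map x = 0.
Proof.
split.
  apply: (ideal_gen_ker (f := system_map)) => _ [[f /pP f0 ->]|[i ->]].
    by apply: etrans (system_map_emb_right f) _; rewrite f0 mpolyC0.
  by apply: etrans (congr1 (map_mpoly phi) (eliminate_Q i)) _; rewrite rmorph0.
move/PS_reinsert => Px; rewrite -(subrK (reinsert (eliminate x)) x).
exact: ideal_genD (PS_congr x) Px.
Qed.

End Kernel.
End System.

Section Counting.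
Local Open Scope ring_scope.

Local Notation indep h := (alg_indep h (fun x => x = 0)).

Variables (K : fieldType) (r s rho : nat) (hrho : (rho <= r)%N) (D : 'I_rho -> nat).
Variables (Lp : fieldType) (phi : {rmorphism {mpoly K[r + s]} -> Lp}).
Hypothesis phi_inj : forall f : {mpoly K[r]}, phi (emb_left s f) = 0 -> f = 0.

Local Notation R := {mpoly K[r + s]}.
Local Notation N := #|Lidx s D|.
Local Notation KLTY := {mpoly K[N + (r + s)]}.
Local Notation B := {mpoly Lp[N]}.
Local Notation L := {fraction B}.

Let h0 : {rmorphism K -> Lp} := phi \o @mpolyC (r + s) K.
Let hB : {rmorphism K -> B} := @mpolyC N Lp \o h0.
Let f : {rmorphism KLTY -> B} := @system_map K r s rho hrho D Lp phi.

Definition free_Lindices : seq 'I_N :=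
  [seq l <- enum 'I_N | ~~ zero_exponent (enum_val l)].
Definition solved_Lindices : seq 'I_N :=
  [seq Lindex (exp0 s D i) | i <- enum 'I_rho].
Definition Timages : seq Lp := [seq phi 'X_(lshift s i) | i <- enum 'I_r].

Let fE x : f x = map_mpoly phi (eliminate hrho x).
Proof. by []. Qed.

Lemma perm_Lindices : perm_eq (enum 'I_N) (free_Lindices ++ solved_Lindices).
Proof.
rewrite -(perm_filterC (fun l => ~~ zero_exponent (enum_val l)) (enum 'I_N)).
rewrite perm_cat2l; apply: uniq_perm.
- by rewrite filter_uniq ?enum_uniq.
- rewrite map_inj_uniq ?enum_uniq // => i j /enum_rank_inj E.
  by have := congr1 (@tag _ _) E.
move=> l; rewrite mem_filter mem_enum andbT /= negbK.
apply/idP/mapP => [|[i _ ->]]; last by rewrite /zero_exponent enum_rankK /=.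
move=> l0; exists (tag (enum_val l)); rewrite ?mem_enum // -[LHS]enum_valK.
congr enum_rank; move: l0; rewrite /zero_exponent.
by case: (enum_val l) => a b /= /eqP->.
Qed.

Lemma Timages_indep : indep h0 Timages.
Proof.
apply/alg_indep_enumP => g g0.
apply: phi_inj; rewrite -[RHS]g0.
apply: (mpoly_rmorph_eq (f := phi \o @emb_left K r s)
  (g := mmap h0 (fun i => phi 'X_(lshift s i)))) => [c|i] /=.
  by rewrite emb_leftC mmapC.
by rewrite emb_leftX mmapX mmap1U.
Qed.

Lemma free_Lindices_uniq : uniq free_Lindices.
Proof. by rewrite filter_uniq ?enum_uniq. Qed.

Lemma free_indep t : indep h0 t ->
  indep hB ([seq 'X_l | l <- free_Lindices] ++ [seq c%:MP | c <- t]).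
Proof.
move=> ind; apply: alg_indep_vars free_Lindices_uniq _.
rewrite -map_comp (eq_map (g := @mpolyC N Lp)) => [|c /=]; last exact: kill_varsC.
apply/(alg_indep_rmorph h0 (@mpolyC N Lp) (fun x => x = 0)).
by apply: alg_indepW ind => x /eqP; rewrite mpolyC_eq0 => /eqP.
Qed.

Lemma system_map_free l : l \in free_Lindices ->
  f 'X_(lshift (r + s) l) = 'X_l.
Proof.
rewrite mem_filter => /andP[/negbTE l0 _].
by rewrite fE eliminate_l /solve_L0 l0 enum_valK map_mpolyX.
Qed.

Lemma system_map_solved (l : 'I_N) (i := tag (enum_val l)) : zero_exponent (enum_val l) ->
  f 'X_(lshift (r + s) l) = (phi 'X_(lshift s (widen_ord hrho i)))%:MP -
    \sum_(b | b != exp0 s D i) 'X_(Lindex b) * (phi (Ymonomial K r b))%:MP.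
Proof.
move=> l0; rewrite fE eliminate_l /solve_L0 l0 rmorphB /= map_mpolyC.
congr (_ - _); rewrite rmorph_sum; apply: eq_bigr => b _.
by rewrite rmorphM /= map_mpolyX map_mpolyC.
Qed.

Lemma Lindex_free i b : (Lindex b \in free_Lindices) = (b != exp0 s D i).
Proof. by rewrite mem_filter mem_enum andbT /zero_exponent enum_rankK. Qed.

Lemma kill_solved i :
  kill_vars free_Lindices (f 'X_(lshift (r + s) (Lindex (exp0 s D i)))) =
  (phi 'X_(lshift s (widen_ord hrho i)))%:MP.
Proof.
rewrite system_map_solved /zero_exponent ?enum_rankK /= ?eqxx //.
rewrite rmorphB /= kill_varsC rmorph_sum big1 ?subr0 // => b b0.
by rewrite rmorphM /= kill_varsX Lindex_free b0 mul0r.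
Qed.

Lemma Lambda_indep : indep hB [seq f 'X_(lshift (r + s) l) | l <- enum 'I_N].
Proof.
apply: (alg_indep_perm (perm_map _ perm_Lindices)); rewrite map_cat.
have /eq_in_map -> : {in free_Lindices, forall l, f 'X_(lshift (r + s) l) = 'X_l}.
  exact: system_map_free.
apply: alg_indep_vars free_Lindices_uniq _.
have -> : [seq kill_vars free_Lindices x |
      x <- [seq f 'X_(lshift (r + s) l) | l <- solved_Lindices]]
    = [seq c%:MP | c <- [seq Timages`_j | j <- iota 0 rho]].
  rewrite -val_enum_ord -!map_comp; apply: eq_map => i.
  rewrite [LHS]kill_solved /=; congr (_%:MP).
  have lt_ir : (i < r)%N := leq_trans (ltn_ord i) hrho.
  rewrite (nth_map (Ordinal lt_ir)) ?size_enum_ord //; congr (phi 'X_(lshift s _)).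
  by apply: val_inj; rewrite /= nth_enum_ord.
apply/(alg_indep_rmorph h0 (@mpolyC N Lp) (fun x => x = 0)).
suff : indep h0 [seq Timages`_j | j <- iota 0 rho].
  by apply: alg_indepW => x /eqP; rewrite mpolyC_eq0 => /eqP.
apply: alg_indep_map Timages_indep; first exact: iota_uniq.
move=> j; rewrite mem_iota size_map size_enum_ord => /andP[_ lt_j].
exact: leq_trans lt_j hrho.
Qed.

Let F : {rmorphism KLTY -> L} := @tofrac B \o f.
Let hF : {rmorphism K -> L} := F \o @mpolyC (N + (r + s)) K.

Lemma indep_tofrac t : indep hB t -> indep hF [seq tofrac x | x <- t].
Proof.
move=> ind; apply: (@eq_alg_indep _ _ (@tofrac B \o hB)).
  by move=> c; rewrite /= fE eliminateC map_mpolyC.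
apply/(alg_indep_rmorph hB (@tofrac B) (fun x => x = 0)).
by apply: alg_indepW ind => x /eqP; rewrite tofrac_eq0 => /eqP.
Qed.

Lemma Lambda_indep_frac :
  indep hF [seq F 'X_(lshift (r + s) l) | l <- enum 'I_N].
Proof. by have := indep_tofrac Lambda_indep; rewrite -map_comp. Qed.

Lemma system_map_left_inj g : F (emb_left (r + s) g) = 0 -> g = 0.
Proof.
move=> g0; have /alg_indep_enumP := Lambda_indep_frac; apply.
rewrite -[RHS]g0.
apply: (mpoly_rmorph_eq (f := mmap hF (fun l => F 'X_(lshift (r + s) l)))
  (g := F \o @emb_left K N (r + s))) => [c|i].
  by rewrite [LHS]mmapC /= emb_leftC.
by rewrite [LHS]mmapX mmap1U /= emb_leftX.
Qed.

(* Both (free coefficients, e0, T) and (e1, Lambda) are transcendence bases of the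
   same field over K, and Lambda has rho more elements than the free part. *)
Lemma system_transcendence_count (e0 : seq Lp) (e1 : seq L) :
    {subset e0 <= [seq phi 'X_(rshift r j) | j <- enum 'I_s]} ->
    indep h0 (e0 ++ Timages) ->
    (forall x, alg_closure h0 (e0 ++ Timages) (phi x)) ->
    {subset e1 <= [seq F 'X_(rshift N j) | j <- enum 'I_(r + s)]} ->
    let X := [seq F 'X_(lshift (r + s) l) | l <- enum 'I_N] in
    indep hF (e1 ++ X) -> (forall x, alg_closure hF (e1 ++ X) (F x)) ->
  size e1 = (size e0 + r - rho)%N.
Proof.
move=> sub0 ind0 clos0 sub1 X ind1 clos1.
pose u : seq L := [seq tofrac x | x <- [seq 'X_l | l <- free_Lindices] ++
  [seq c%:MP | c <- e0 ++ Timages]].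
have ind_u : indep hF u by apply/indep_tofrac/free_indep.
have FR (x : R) : F (emb_right N x) = tofrac ((phi x)%:MP : B).
  by rewrite /= fE eliminate_emb_right map_mpolyC.
have clos_u x : alg_closure hF u (F x).
  have clR (y : R) : alg_closure hF u (F (emb_right N y)).
    rewrite FR; pose g : {rmorphism Lp -> L} := @tofrac B \o @mpolyC N Lp.
    have : alg_closure hF (map g (e0 ++ Timages)) (g (phi y)).
      apply: (alg_closure_rmorph (h := h0)) => // c.
      by rewrite /= fE eliminateC map_mpolyC.
    have -> : map g (e0 ++ Timages) =
        [seq tofrac (x : B) | x <- [seq c%:MP | c <- e0 ++ Timages]].
      by rewrite -[RHS]map_comp.
    by apply: alg_closure_sub => z zs; rewrite /u map_cat mem_cat zs orbT.
  have clX l : l \in free_Lindices -> alg_closure hF u (tofrac ('X_l : B)).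
    move=> lf; apply: AlgClosureGen; rewrite /u map_cat mem_cat.
    by rewrite -map_comp (map_f (fun l => tofrac ('X_l : B))).
  elim/mpoly_ring_ind: x => [c|k|x y cx cy|x y cx cy].
  - exact: AlgClosureBase.
  - case: (split_ordP k) => [l|j] ->; last by rewrite -emb_rightX.
    have [lf|] := boolP (l \in free_Lindices).
      by rewrite [F _]/(tofrac (f _)) system_map_free //; apply: clX.
    rewrite mem_filter mem_enum andbT negbK => l0.
    rewrite -[F _]/(tofrac (f _)) system_map_solved // rmorphB rmorph_sum /=.
    apply: alg_closureB; first by rewrite -FR.
    apply: big_ind => [||b b0].
    + by rewrite -(rmorph0 hF); apply: AlgClosureBase.
    + exact: AlgClosureD.
    rewrite tofracM; apply: AlgClosureM; last by rewrite -FR.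
    by apply: clX; rewrite Lindex_free.
  - by rewrite rmorphD; apply: AlgClosureD.
  - by rewrite rmorphM; apply: AlgClosureM.
have le1 : (size (e1 ++ X) <= size u)%N.
  apply: steinitz ind1 _ => x; rewrite mem_cat => /orP[/sub1|] /mapP[j _ ->];
    exact: clos_u.
have le2 : (size u <= size (e1 ++ X))%N.
  apply: steinitz ind_u _ => x; rewrite /u map_cat mem_cat -!map_comp map_cat.
  rewrite mem_cat => /or3P[] /mapP[] y yy -> /=.
  - by rewrite -(system_map_free yy); apply: clos1.
  - have /mapP[j _ ->] := sub0 _ yy.
    by rewrite -FR; apply: clos1.
  - have /mapP[j _ ->] := yy.
    by rewrite -FR; apply: clos1.
have szN : N = (size free_Lindices + rho)%N.
  rewrite -[LHS]size_enum_ord (perm_size perm_Lindices) size_cat.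
  by rewrite [size solved_Lindices]size_map size_enum_ord.
have szE : size (e1 ++ X) = size u by apply/eqP; rewrite eqn_leq le1 le2.
have szT : size Timages = r by rewrite size_map size_enum_ord.
have szX : size X = N by rewrite size_map size_enum_ord.
have szu : size u = (size free_Lindices + (size e0 + r))%N.
  by rewrite size_map size_cat !size_map size_cat szT.
move: szE; rewrite size_cat szX szu; move: szN; lia.
Qed.

End Counting.

Theorem theorem3p7 (K : fieldType) (r s : nat)
    (p : {mpoly K[r + s]} -> Prop) (d : nat)
    (hp : is_prime_ideal p)
    (hpT : forall f : {mpoly K[r]}, p (emb_left s f) <-> f = 0%R)
    (hd : krull_dim_quot (ideal_ext (to_generic r s) p) d)
    (hd0 : 0 < d)
    (rho : nat) (hrho0 : 0 < rho) (hrho : rho <= r)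
    (D : 'I_rho -> nat) :
  [/\ is_prime_ideal (PS D p hrho),
      forall f : {mpoly K[#|Lidx s D|]},
        PS D p hrho (emb_left (r + s) f) <-> f = 0%R
    & krull_dim_quot
        (ideal_ext (to_generic #|Lidx s D| (r + s)) (PS D p hrho))
        (d + r - rho)].
Proof.
have [J pJ] := hp; have [Lp [phi phiP]] := prime_idealr_kernel J.
have pP x : p x <-> phi x = 0%R.
  by rewrite pJ -phiP; split=> /eqP.
have phi_inj (f : {mpoly K[r]}) : phi (emb_left s f) = 0%R -> f = 0%R.
  by move/pP/hpT.
pose F : {rmorphism _ -> {fraction {mpoly Lp[#|Lidx s D|]}}} :=
  @tofrac {mpoly Lp[#|Lidx s D|]} \o @system_map K r s rho hrho D Lp phi.
have PSP x : PS D p hrho x <-> F x = 0%R.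
  have kerP := PS_kernel hrho (D := D) pP x.
  split=> [/kerP x0|/eqP]; first by rewrite /F /= x0 tofrac0.
  by rewrite /F /= tofrac_eq0 => /eqP/kerP.
have F_inj := system_map_left_inj (hrho := hrho) (D := D) phi_inj.
split.
- exists (kernel F : prime_idealr _) => x; rewrite unfold_in /kernel.
  by split=> [/PSP/eqP|/eqP/PSP].
- by move=> f; split=> [/PSP/F_inj|->] //; apply/PSP; rewrite !rmorph0.
have [e0 [/mem_subseq sub0 ind0 clos0 dim0]] := generic_dimension phi_inj pP.
have [e1 [/mem_subseq sub1 ind1 clos1 dim1]] := generic_dimension F_inj PSP.
apply/dim1; move/dim0: hd => ->.
have := system_transcendence_count (hrho := hrho) (D := D) sub0 ind0 clos0 sub1 ind1 clos1.
by move->.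
Qed.
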